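(* Let $\sigma,\tau:\mathbb{Z}\to(0,\infty)$ be Beurling weights such that $\tau/\sigma$ is decreasing on $\mathbb{N}$. Let $\mu = h\,\mathrm{d}x$ be a positive measure on $\mathbb{T}$ with $M^{-1}\le h(x)\le M$ on $\mathbb{T}$ and $\|\sigma\,\mathcal{F}[(\log h)']\|_{\ell^q(\mathbb{Z})}\le A$ for some $q<\infty$. Then there is a constant $C_{\mathcal P}$, increasing in and dependent only on $q, A, M$, such that for all integers $K\ge 1$ $$\|I-\mathcal{P}_K\|_{W^\sigma\to W^\tau}\;\le\; C_{\mathcal P}\,\|I-\mathcal{D}_K\|_{W^\sigma\to W^\tau} \;=\; C_{\mathcal P}\,\frac{\tau(K)}{\sigma(K)},$$ where $\mathcal{P}_K$ is the $L^2(\mu)$-orthogonal projection onto trigonometric polynomials of degree less than $K$ and $\mathcal{D}_K$ is convolution with the Dirichlet kernel.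
   Context: $\mathbb{T}=\mathbb{R}/2\pi\mathbb{Z}$, functions are complex-valued, and $\mathcal{F}$ denotes the Fourier series operator $(\mathcal{F}\varphi)(k)=\frac1{2\pi}\int_{\mathbb T}e^{-ikx}\varphi(x)\,\mathrm{d}x$, $k\in\mathbb{Z}$ (extended to distributions; $\mathcal F[\varphi'](k)=ik\,\mathcal F[\varphi](k)$). The exponent satisfies $q\in[1,\infty)$. A Beurling weight is an even function $\sigma:\mathbb{Z}\to(0,\infty)$ that is non-decreasing on $\mathbb{N}=\{0,1,2,\dots\}$ and satisfies $\sigma(|j|+|k|)\le\sigma(j)\sigma(k)$ for all $j,k\in\mathbb{Z}$. For a Beurling weight $\sigma$, $W^\sigma$ is the Hilbert space of $\varphi\in L^2(\mathbb{T})$ with $\|\varphi\|_{W^\sigma}:=\|\sigma\mathcal{F}\varphi\|_{\ell^2(\mathbb{Z})}<\infty$. ''Decreasing'' is meant in the non-strict sense. Trigonometric polynomials of degree less than $K$ are the elements of $\mathrm{span}\{e^{ikx}:|k|\le K-1\}$. $\mathcal{D}_K$ is the Fourier truncation $(\mathcal{D}_K\psi)(x)=\sum_{|k|\le K-1}(\mathcal{F}\psi)(k)e^{ikx}$. *)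

(* Defs.v *)
From HB Require Import structures.
From mathcomp Require Import all_boot all_order all_algebra.
From mathcomp Require Import complex.
From mathcomp Require Import all_classical all_reals all_analysis.

Set Implicit Arguments.
Unset Strict Implicit.
Unset Printing Implicit Defensive.

Import Order.TTheory GRing.Theory Num.Theory.

Local Open Scope classical_set_scope.
Local Open Scope ring_scope.
Local Open Scope complex_scope.

(* Functions on the circle R / 2 pi Z are 2 pi-periodic functions on R, and
   integrals over the circle are integrals over the fundamental domain
   ]-pi, pi].  A class in L^2 is represented by any of its members. *)
Definition circle (R : realType) : set R := `]- pi, pi].
Arguments circle R : clear implicits.

Definition on_circle (R : realType) (V : zmodType) (f : R -> V) : Prop :=
  periodic f (2 * pi).

Definition cmeasurable (R : realType) (f : R -> R[i]) : Prop :=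
  measurable_fun [set: R] (fun x => complex.Re (f x)) /\
  measurable_fun [set: R] (fun x => complex.Im (f x)).

Definition cintegral (R : realType) (mu : {measure set (measurableTypeR R) -> \bar R})
    (f : R -> R[i]) : R[i] :=
  (\int[mu]_(x in circle R) complex.Re (f x)) +i*
  (\int[mu]_(x in circle R) complex.Im (f x)).

Definition L2_circle (R : realType) (f : R -> R[i]) : Prop :=
  [/\ on_circle f, cmeasurable f &
      (\int[@lebesgue_measure R]_(x in circle R) ((ComplexField.Normc.normc (f x)) ^+ 2)%:E
        < +oo)%E].

(* k |-> e^{ikx} *)
Definition expi (R : realType) (k : int) (x : R) : R[i] :=
  cos (k%:~R * x) +i* sin (k%:~R * x).

Definition fourier (R : realType) (f : R -> R[i]) (k : int) : R[i] :=
  ((2 * pi)^-1)%:C *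
  cintegral (@lebesgue_measure R) (fun x => expi (- k) x * f x).

(* Fourier coefficients of the distributional derivative f', namely
   <f', e^{-ikx}> / 2 pi = - <f, (e^{-ikx})'> / 2 pi = i k (F f)(k);
   f itself need not be differentiable. *)
Definition fourier_deriv (R : realType) (f : R -> R[i]) (k : int) : R[i] :=
  (0 +i* k%:~R) * fourier f k.

(* the l^q(Z) norm, with value +oo outside l^q(Z) *)
Definition lnorm (R : realType) (q : R) (a : int -> R[i]) : \bar R :=
  ((\esum_(k in [set: int]) ((ComplexField.Normc.normc (a k)) `^ q)%:E) `^ q^-1)%E.

Record beurling_weight (R : realType) (sigma : int -> R) : Prop := {
  beurling_gt0 : forall k, 0 < sigma k;
  beurling_even : forall k, sigma (- k) = sigma k;
  beurling_nondecreasing :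
    forall m n : nat, (m <= n)%N -> sigma m%:Z <= sigma n%:Z;
  beurling_submul : forall j k, sigma (`|j| + `|k|) <= sigma j * sigma k }.

Definition Wnorm (R : realType) (sigma : int -> R) (f : R -> R[i]) : \bar R :=
  lnorm 2 (fun k => (sigma k)%:C * fourier f k).

Definition W (R : realType) (sigma : int -> R) : set (R -> R[i]) :=
  [set f | L2_circle f /\ (Wnorm sigma f < +oo)%E].

(* norm of A : W^sigma -> W^tau, with value +oo if A is unbounded *)
Definition opnorm (R : realType) (sigma tau : int -> R)
    (A : (R -> R[i]) -> (R -> R[i])) : \bar R :=
  ereal_sup [set Wnorm tau (A f) | f in
              [set f | W sigma f /\ (Wnorm sigma f <= 1)%E]].

Definition idB (R : realType) (P : (R -> R[i]) -> (R -> R[i])) :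
    (R -> R[i]) -> (R -> R[i]) :=
  fun f x => f x - P f x.

Definition freqs (K : nat) : set int := [set k | `|k| <= K%:Z - 1].

Definition trigpoly (R : realType) (K : nat) : set (R -> R[i]) :=
  [set p | exists c : int -> R[i],
     p = fun x => \sum_(k \in freqs K) c k * expi k x].

Definition truncation (R : realType) (K : nat) (f : R -> R[i]) : R -> R[i] :=
  fun x => \sum_(k \in freqs K) fourier f k * expi k x.

Definition inner (R : realType) (mu : {measure set (measurableTypeR R) -> \bar R})
    (f g : R -> R[i]) : R[i] :=
  cintegral mu (fun x => f x * (g x)^*%C).

Definition is_orthproj (R : realType) (mu : {measure set (measurableTypeR R) -> \bar R})
    (K : nat) (f p : R -> R[i]) : Prop :=
  trigpoly K p /\
  forall g, trigpoly K g -> inner mu (fun x => f x - p x) g = 0.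

(* the orthogonal projection of f, selected by choice; the value 0 is used only
   when no trigonometric polynomial satisfies is_orthproj *)
Definition orthproj (R : realType) (mu : {measure set (measurableTypeR R) -> \bar R}) (K : nat)
    (f : R -> R[i]) : R -> R[i] :=
  xget (fun=> 0) [set p | is_orthproj mu K f p].

(* mu = h dx on the circle *)
Definition has_density (R : realType) (mu : {measure set (measurableTypeR R) -> \bar R})
    (h : R -> R) : Prop :=
  forall A : set R, measurable A -> A `<=` circle R ->
    mu A = (\int[@lebesgue_measure R]_(x in A) (h x)%:E)%E.

(* Main.v *)
(* Write Q = I - D_K and let r = f - P_K f.  Since P_K f is the best approximation
   in L^2(mu) and M^-1 <= h <= M, |r|_{L^2} <= M |Q f|_{L^2}.  Above frequency K the
   coefficients of r are those of f, and there tau <= (tau(K)/sigma(K)) sigma.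
   Below K monotonicity gives tau <= tau(K), so that part of |r|_{W^tau} is at most
   tau(K) M |Q f|_{L^2} <= M (tau(K)/sigma(K)) |f|_{W^sigma}, because
   sigma >= sigma(K) on the frequencies of Q f.  Adding the squares of the two
   parts gives C = sqrt(1 + M^2).

   The bound on |Q f|_{L^2} needs Parseval, that is, density of trigonometric
   polynomials in L^2.  The L^2-closure of these polynomials is an algebra on
   bounded functions, closed under dominated limits, so the sets whose indicator
   it contains form a sigma-algebra; this contains the arcs, whose indicators are
   the limits of (1 - s^n)^(2^n) with s an affine image of cos(x - x0). *)
Require Import Defs.
From HB Require Import structures.
From mathcomp Require Import all_boot all_order all_algebra.
From mathcomp Require Import complex ring lra zify.
From mathcomp Require Import all_classical all_reals all_analysis measurable_realfun.

Set Implicit Arguments.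
Unset Strict Implicit.
Unset Printing Implicit Defensive.

Import Order.TTheory GRing.Theory Num.Theory.
Import numFieldNormedType.Exports.
Import ComplexField.Normc.

Local Open Scope classical_set_scope.
Local Open Scope ring_scope.
Local Open Scope complex_scope.

(** * Square-integrable functions on the circle *)

Section square_integrable.
Variable R : realType.
Implicit Types (f g p : R -> R[i]) (m : {measure set (measurableTypeR R) -> \bar R}).

Lemma normc_sqr (z : R[i]) : normc z ^+ 2 = complex.Re z ^+ 2 + complex.Im z ^+ 2.
Proof. by case: z => a b /=; rewrite sqr_sqrtr// addr_ge0// sqr_ge0. Qed.

Lemma normc_ge0 (z : R[i]) : 0 <= normc z.
Proof. by case: z => a b /=; exact: sqrtr_ge0. Qed.

Lemma normc_sqrD (z w : R[i]) :
  normc (z + w) ^+ 2 <= 2 * normc z ^+ 2 + 2 * normc w ^+ 2.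
Proof.
rewrite !normc_sqr; case: z => a b; case: w => c d /=.
have := sqr_ge0 (a - c); have := sqr_ge0 (b - d); nra.
Qed.

Lemma measurable_circle : measurable (circle R : set (measurableTypeR R)).
Proof. exact: measurable_itv. Qed.
Hint Resolve measurable_circle : core.

Lemma cmeasurableD f g :
  cmeasurable f -> cmeasurable g -> cmeasurable (fun x => f x + g x).
Proof.
move=> [f1 f2] [g1 g2]; split.
- by under eq_fun do rewrite raddfD; exact: measurable_funD.
- by under eq_fun do rewrite raddfD; exact: measurable_funD.
Qed.

Lemma cmeasurableM f g :
  cmeasurable f -> cmeasurable g -> cmeasurable (fun x => f x * g x).
Proof.
move=> [f1 f2] [g1 g2]; split.
- rewrite (_ : (fun _ => _) = (fun x => complex.Re (f x) * complex.Re (g x)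
      - complex.Im (f x) * complex.Im (g x))); last first.
    by apply/funext => x; case: (f x) => ? ?; case: (g x).
  by apply: measurable_funB; apply: measurable_funM.
- rewrite (_ : (fun _ => _) = (fun x => complex.Re (f x) * complex.Im (g x)
      + complex.Im (f x) * complex.Re (g x))); last first.
    by apply/funext => x; case: (f x) => ? ?; case: (g x).
  by apply: measurable_funD; apply: measurable_funM.
Qed.

Lemma cmeasurable_cst (c : R[i]) : cmeasurable (fun _ : R => c).
Proof. by split; exact: measurable_cst. Qed.

Lemma cmeasurableJ f : cmeasurable f -> cmeasurable (fun x => (f x)^*%C).
Proof.
move=> [f1 f2]; split.
- by rewrite (_ : (fun _ => _) = (fun x => complex.Re (f x)))//;
    apply/funext => x; case: (f x).
- rewrite (_ : (fun _ => _) = (fun x => - complex.Im (f x))).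
    exact: measurable_funN.
  by apply/funext => x; case: (f x).
Qed.

Lemma cmeasurable_normc_sqr f : cmeasurable f ->
  measurable_fun [set: R] (fun x => normc (f x) ^+ 2).
Proof.
move=> [f1 f2]; under eq_fun do rewrite normc_sqr.
by apply: measurable_funD; apply: measurable_funX.
Qed.

(** The measure is a parameter so that the same Hilbert space lemmas serve both Lebesgue measure and
    [mu]. *)
Definition L2 m f := cmeasurable f /\
  m.-integrable (circle R) (fun x => (normc (f x) ^+ 2)%:E).

(** The squared norm as a real number. When the integral is infinite it takes the default value 0,
    so it is meaningful only together with [L2 m f]. *)
Definition sqnorm m f : R := \int[m]_(x in circle R) (normc (f x) ^+ 2).

Definition cintegrable m f :=
  m.-integrable (circle R) (fun x => (complex.Re (f x))%:E) /\
  m.-integrable (circle R) (fun x => (complex.Im (f x))%:E).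

Lemma L2P m f : cmeasurable f ->
  (\int[m]_(x in circle R) ((normc (f x)) ^+ 2)%:E < +oo)%E -> L2 m f.
Proof.
move=> mf foo; split => //; apply/integrableP; split.
  apply/measurable_EFinP; apply: measurable_funTS.
  exact: cmeasurable_normc_sqr.
apply: le_lt_trans foo; rewrite le_eqVlt; apply/predU1P; left.
by apply: eq_integral => x _ /=; rewrite ger0_norm// sqr_ge0.
Qed.

Lemma sqnormE m f : L2 m f ->
  (\int[m]_(x in circle R) ((normc (f x)) ^+ 2)%:E)%E = (sqnorm m f)%:E.
Proof.
by move=> [_ fi]; rewrite /sqnorm /Rintegral fineK// integrable_fin_num.
Qed.

Lemma sqnorm_ge0 m f : 0 <= sqnorm m f.
Proof. by apply: Rintegral_ge0 => x _; rewrite sqr_ge0. Qed.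

Lemma L2_le m f g : cmeasurable f -> L2 m g ->
  (forall x, normc (f x) ^+ 2 <= normc (g x) ^+ 2) -> L2 m f.
Proof.
move=> mf [mg ig] fg; split => //; apply: le_integrable ig => //.
  apply/measurable_EFinP; apply: measurable_funTS.
  exact: cmeasurable_normc_sqr.
by move=> x _ /=; rewrite lee_fin !ger0_norm// sqr_ge0.
Qed.

Lemma L2D m f g : L2 m f -> L2 m g -> L2 m (fun x => f x + g x).
Proof.
move=> [mf fi] [mg gi]; have mfg := cmeasurableD mf mg; split => //.
have : m.-integrable (circle R)
    (fun x => 2%:E * (normc (f x) ^+ 2)%:E + 2%:E * (normc (g x) ^+ 2)%:E)%E.
  by apply: integrableD => //; apply: integrableZl.
apply: le_integrable => //.
  apply/measurable_EFinP; apply: measurable_funTS.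
  exact: cmeasurable_normc_sqr.
move=> x _ /=; rewrite lee_fin !ger0_norm ?sqr_ge0//.
  exact: normc_sqrD.
by rewrite addr_ge0// mulr_ge0// sqr_ge0.
Qed.

Lemma L2_bounded_mul m f g (B : R) : L2 m f -> cmeasurable g ->
  (forall x, normc (g x) <= B) -> L2 m (fun x => f x * g x).
Proof.
move=> [mf fi] mg gB; have mfg := cmeasurableM mf mg; split => //.
have : m.-integrable (circle R) (fun x => (B ^+ 2)%:E * (normc (f x) ^+ 2)%:E)%E.
  by apply: integrableZl.
apply: le_integrable => //.
  apply/measurable_EFinP; apply: measurable_funTS.
  exact: cmeasurable_normc_sqr.
move=> x _ /=; rewrite lee_fin !ger0_norm ?sqr_ge0//; last first.
  by rewrite mulr_ge0// sqr_ge0.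
rewrite normcM exprMn mulrC ler_wpM2r ?sqr_ge0// ler_sqr ?nnegrE ?normc_ge0//.
by rewrite (le_trans _ (gB x))// normc_ge0.
Qed.

Lemma L2Z m f (c : R[i]) : L2 m f -> L2 m (fun x => c * f x).
Proof.
move=> f2; under eq_fun do rewrite mulrC.
exact: (@L2_bounded_mul _ _ _ (normc c) f2 (cmeasurable_cst c)).
Qed.

Lemma L2N m f : L2 m f -> L2 m (fun x => - f x).
Proof. by move=> /(L2Z (-1)); under eq_fun do rewrite mulN1r. Qed.

Lemma L2B m f g : L2 m f -> L2 m g -> L2 m (fun x => f x - g x).
Proof. by move=> f2 g2; apply: L2D => //; exact: L2N. Qed.

Lemma L2_bounded m f (B : R) : (m (circle R) < +oo)%E -> cmeasurable f ->
  (forall x, normc (f x) <= B) -> L2 m f.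
Proof.
move=> moo mf fB.
have L21 : L2 m (fun=> 1).
  split; first exact: cmeasurable_cst.
  apply: (@eq_integrable _ _ _ m _ _ (cst 1%:E)) => //.
    by move=> x _; rewrite normc_sqr /= expr1n expr0n addr0.
  apply/integrableP; split; first exact: measurable_cst.
  by rewrite integral_cst//= normr1 mul1e.
by have := L2_bounded_mul L21 mf fB; under eq_fun do rewrite mul1r.
Qed.

Lemma L2_sum m (s : seq int) (F : int -> R -> R[i]) : (m (circle R) < +oo)%E ->
  (forall k, L2 m (F k)) -> L2 m (fun x => \sum_(k <- s) F k x).
Proof.
move=> moo F2; elim: s => [|k s IH].
  under eq_fun do rewrite big_nil.
  by apply: (@L2_bounded _ _ 0 moo (cmeasurable_cst 0)) => x; rewrite normc0.
by under eq_fun do rewrite big_cons; apply: L2D.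
Qed.

(** Both parts of f times the conjugate of g are at most |f|^2 + |g|^2 in absolute value. The
    squares of a - c, a + c and so on supply the two signs. *)
Lemma L2_cintegrable m f g : L2 m f -> L2 m g ->
  cintegrable m (fun x => f x * (g x)^*%C).
Proof.
move=> [mf fi] [mg gi].
have [m1 m2] := cmeasurableM mf (cmeasurableJ mg).
have fgi : m.-integrable (circle R)
    (fun x => (normc (f x) ^+ 2)%:E + (normc (g x) ^+ 2)%:E)%E.
  exact: integrableD.
split; apply: le_integrable fgi => //.
- by apply/measurable_EFinP; exact: measurable_funTS.
- move=> x _ /=; rewrite lee_fin [leRHS]ger0_norm ?addr_ge0 ?sqr_ge0//.
  rewrite !normc_sqr ler_norml; case: (f x) => a b; case: (g x) => c d /=.
  have := sqr_ge0 (a - c); have := sqr_ge0 (b - d).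
  have := sqr_ge0 (a + c); have := sqr_ge0 (b + d).
  by move=> ? ? ? ?; apply/andP; split; nra.
- by apply/measurable_EFinP; exact: measurable_funTS.
- move=> x _ /=; rewrite lee_fin [leRHS]ger0_norm ?addr_ge0 ?sqr_ge0//.
  rewrite !normc_sqr ler_norml; case: (f x) => a b; case: (g x) => c d /=.
  have := sqr_ge0 (a - d); have := sqr_ge0 (b - c).
  have := sqr_ge0 (a + d); have := sqr_ge0 (b + c).
  by move=> ? ? ? ?; apply/andP; split; nra.
Qed.

(** * Linearity of the complex integral and the inner product of L^2(m) *)

Lemma cintegralD m f g : cintegrable m f -> cintegrable m g ->
  cintegral m (fun x => f x + g x) = cintegral m f + cintegral m g.
Proof.
move=> [f1 f2] [g1 g2]; rewrite /cintegral; simpc; congr (_ +i* _).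
  by under eq_Rintegral do rewrite raddfD /=; rewrite RintegralD.
by under eq_Rintegral do rewrite raddfD /=; rewrite RintegralD.
Qed.

Lemma cintegralZ m f (c : R[i]) : cintegrable m f ->
  cintegral m (fun x => c * f x) = c * cintegral m f.
Proof.
move=> [f1 f2]; rewrite /cintegral; case: c => a b; simpc.
have Z (u : R -> R) (t : R) : m.-integrable (circle R) (fun x => (u x)%:E) ->
    m.-integrable (circle R) (fun x => (t * u x)%:E).
  by move=> ui; under eq_fun do rewrite EFinM; apply: integrableZl.
congr (_ +i* _).
  under eq_Rintegral.
    move=> x _; rewrite (_ : complex.Re _
      = a * complex.Re (f x) - b * complex.Im (f x)); last by case: (f x).
    over.
  rewrite RintegralB//; [|exact: Z..].
  by rewrite !RintegralZl.
under eq_Rintegral.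
  move=> x _; rewrite (_ : complex.Im _
    = a * complex.Im (f x) + b * complex.Re (f x)); last by case: (f x).
  over.
rewrite RintegralD//; [|exact: Z..].
by rewrite !RintegralZl.
Qed.

Lemma cintegralJ m f : cintegrable m f ->
  cintegral m (fun x => (f x)^*%C) = (cintegral m f)^*%C.
Proof.
move=> [_ f2]; rewrite /cintegral /=; congr (_ +i* _).
  by apply: eq_Rintegral => x _; case: (f x).
under eq_Rintegral.
  move=> x _; rewrite (_ : complex.Im _ = (-1) * complex.Im (f x)); last first.
    by case: (f x) => a b /=; rewrite mulN1r.
  over.
by rewrite RintegralZl// mulN1r.
Qed.

Lemma innerC m f g : L2 m f -> L2 m g -> inner m g f = (inner m f g)^*%C.
Proof.
move=> f2 g2; rewrite /inner -cintegralJ; last exact: L2_cintegrable.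
by congr cintegral; apply/funext => x; rewrite rmorphM/= conjcK mulrC.
Qed.

Lemma innerDl m f g p : L2 m f -> L2 m g -> L2 m p ->
  inner m (fun x => f x + g x) p = inner m f p + inner m g p.
Proof.
move=> f2 g2 p2; rewrite /inner -cintegralD; [|exact: L2_cintegrable..].
by congr cintegral; apply/funext => x; rewrite mulrDl.
Qed.

Lemma innerZl m f p c : L2 m f -> L2 m p ->
  inner m (fun x => c * f x) p = c * inner m f p.
Proof.
move=> f2 p2; rewrite /inner -cintegralZ; [|exact: L2_cintegrable..].
by congr cintegral; apply/funext => x; rewrite mulrA.
Qed.

Lemma innerBl m f g p : L2 m f -> L2 m g -> L2 m p ->
  inner m (fun x => f x - g x) p = inner m f p - inner m g p.
Proof.
move=> f2 g2 p2; rewrite innerDl//; last exact: L2N.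
congr (_ + _); rewrite -mulN1r -innerZl//.
by congr inner; apply/funext => x; rewrite mulN1r.
Qed.

Lemma innerDr m f g p : L2 m f -> L2 m g -> L2 m p ->
  inner m p (fun x => f x + g x) = inner m p f + inner m p g.
Proof.
move=> f2 g2 p2; rewrite innerC//; last exact: L2D.
by rewrite innerDl// (innerC f2 p2) (innerC g2 p2) rmorphD.
Qed.

Lemma innerZr m f p c : L2 m f -> L2 m p ->
  inner m p (fun x => c * f x) = c^*%C * inner m p f.
Proof.
move=> f2 p2; rewrite innerC//; last exact: L2Z.
by rewrite innerZl// (innerC f2 p2) rmorphM.
Qed.

Lemma inner0l m g : inner m (fun=> 0) g = 0.
Proof.
rewrite /inner /cintegral.
under eq_Rintegral do rewrite mul0r.
under [X in _ +i* X]eq_Rintegral do rewrite mul0r.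
by rewrite /= Rintegral_cst// mul0r.
Qed.

Lemma inner_sum m (s : seq int) (F : int -> R -> R[i]) g : (m (circle R) < +oo)%E ->
  (forall k, L2 m (F k)) -> L2 m g ->
  inner m (fun x => \sum_(k <- s) F k x) g = \sum_(k <- s) inner m (F k) g.
Proof.
move=> moo F2 g2; elim: s => [|k s IH].
  by rewrite big_nil; under eq_fun do rewrite big_nil; rewrite inner0l.
under eq_fun do rewrite big_cons.
by rewrite innerDl// ?big_cons ?IH//; apply: L2_sum.
Qed.

Lemma inner_self m f : inner m f f = (sqnorm m f)%:C.
Proof.
rewrite /inner /cintegral /sqnorm; congr (_ +i* _).
  by apply: eq_Rintegral => x _; rewrite normc_sqr; case: (f x) => a b /=; ring.
rewrite (_ : (fun x => _) = cst 0); last first.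
  by apply/funext => x; case: (f x) => a b /=; ring.
by rewrite Rintegral_cst// mul0r.
Qed.

Lemma sqnormD m f g : L2 m f -> L2 m g ->
  sqnorm m (fun x => f x + g x) =
    sqnorm m f + sqnorm m g + 2 * complex.Re (inner m f g).
Proof.
move=> f2 g2; have fg2 := L2D f2 g2; apply: complexI; rewrite -inner_self.
rewrite innerDl// !innerDr// (innerC f2 g2) !inner_self.
case: (inner m f g) => a b; apply/eqP.
by rewrite eq_complex /=; apply/andP; split; apply/eqP; ring.
Qed.

Lemma sqnorm_pythagoras m f g : L2 m f -> L2 m g -> inner m f g = 0 ->
  sqnorm m (fun x => f x + g x) = sqnorm m f + sqnorm m g.
Proof. by move=> f2 g2 fg; rewrite sqnormD// fg mulr0 addr0. Qed.

Lemma sqnormZ m f c : L2 m f -> sqnorm m (fun x => c * f x) = normc c ^+ 2 * sqnorm m f.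
Proof.
move=> [_ f2]; rewrite /sqnorm -RintegralZl//.
by apply: eq_Rintegral => x _; rewrite normcM exprMn.
Qed.

(** Cauchy-Schwarz in the degenerate case. With z the inner product, expanding the squared norm of f
    - t z g leaves |f|^2 - 2 t |z|^2, which stays nonnegative for every real t only if z = 0. *)
Lemma sqnorm0_inner m f g : L2 m f -> L2 m g -> sqnorm m g = 0 -> inner m f g = 0.
Proof.
move=> f2 g2 g0; set z := inner m f g.
have H (t : R) : 0 <= sqnorm m f - 2 * t * normc z ^+ 2.
  have g2' := L2Z (- (t%:C * z)) g2.
  have := sqnorm_ge0 m (fun x => f x + - (t%:C * z) * g x).
  rewrite sqnormD// sqnormZ// g0 mulr0 addr0 innerZr// -/z.
  clear g2'; rewrite normc_sqr; case: z => a b /=; rewrite !mul0r; lra.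
(* If |f| = 0, then t = 1 already forces z = 0. Otherwise t = |f|^2 / |z|^2 turns the bound into 0
   <= - |f|^2. *)
have := sqnorm_ge0 m f; rewrite le_eqVlt => /predU1P[f0|f0].
  have := H 1; rewrite -f0 mulr1 sub0r => h; apply: eq0_normc.
  by apply/eqP; rewrite -sqrf_eq0 eq_le sqr_ge0 andbT; lra.
apply: eq0_normc; apply/eqP; rewrite -sqrf_eq0; apply/negPn/negP => z0.
have := H (sqnorm m f / normc z ^+ 2).
by rewrite -mulrA divfK//; lra.
Qed.

End square_integrable.

(** * Fourier coefficients and trigonometric polynomials *)

Section trigonometric_polynomials.
Variable R : realType.
Implicit Types (f g p : R -> R[i]) (m : {measure set (measurableTypeR R) -> \bar R}).
Local Notation leb := (@lebesgue_measure R).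

Lemma expiJ k (x : R) : (expi k x)^*%C = expi (- k) x.
Proof. by rewrite /expi /= rmorphN/= mulNr cosN sinN. Qed.

Lemma expiD j k (x : R) : expi (j + k) x = expi j x * expi k x.
Proof.
rewrite /expi rmorphD/= mulrDl cosD sinD; apply/eqP.
by rewrite eq_complex /=; apply/andP; split; apply/eqP; ring.
Qed.

Lemma expi0 (x : R) : expi 0 x = 1.
Proof. by rewrite /expi mul0r cos0 sin0. Qed.

Lemma normc_expi k (x : R) : normc (expi k x) = 1.
Proof. by rewrite /= cos2Dsin2 sqrtr1. Qed.

Lemma cmeasurable_expi k : cmeasurable (@expi R k).
Proof.
have mk : measurable_fun [set: R] (fun x : R => k%:~R * x).
  by apply: measurable_funM => //; exact: measurable_cst.
split.
  by apply: measurableT_comp mk; apply: continuous_measurable_fun; exact: continuous_cos.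
by apply: measurableT_comp mk; apply: continuous_measurable_fun; exact: continuous_sin.
Qed.

Lemma L2_expi m k : (m (circle R) < +oo)%E -> L2 m (@expi R k).
Proof.
move=> moo; apply: (L2_bounded (B := 1) moo (cmeasurable_expi k)) => x.
by rewrite normc_expi.
Qed.

Lemma lebesgue_circle : leb (circle R) = (2 * pi)%:E.
Proof.
rewrite lebesgue_measure_itv/= lte_fin gtrN ?pi_gt0// -EFinD; congr EFin.
by rewrite opprK; ring.
Qed.

Lemma lebesgue_circle_fin : (leb (circle R) < +oo)%E.
Proof. by rewrite lebesgue_circle ltry. Qed.

Lemma integral_circle_derive (F f : R -> R) : continuous f ->
  (forall x : R, is_derive x 1 F (f x)) ->
  \int[leb]_(x in circle R) f x = F pi - F (- pi).
Proof.
move=> cf dF; have npi : - pi < pi :> R by rewrite gtrN ?pi_gt0.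
have cF : continuous F.
  by move=> x; apply: differentiable_continuous; apply/derivable1_diffP; case: (dF x).
(* The fundamental theorem is applied on a closed interval; adding the endpoint [- pi] does not
   change the integral. *)
rewrite /Rintegral /circle integral_itv_obnd_cbnd; last first.
  apply/measurable_EFinP; apply: measurable_funTS.
  exact: continuous_measurable_fun.
rewrite (@continuous_FTC2 _ f F)//.
- by apply: continuous_subspaceT.
- split=> [x _||].
  + by case: (dF x).
  + by apply: cvg_at_right_filter; exact: cF.
  + by apply: cvg_at_left_filter; exact: cF.
- by move=> x _; rewrite derive1E; case: (dF x).
Qed.

Lemma is_derive_mulr (a x : R) : is_derive x (1 : R) (fun y => a * y) a.
Proof.
rewrite (_ : (fun _ => _) = (a \*: id))//.
by apply: is_derive_eq; rewrite /GRing.scale /= mulr1.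
Qed.

Lemma sin_pi_mulrn n : sin (pi *+ n) = 0 :> R.
Proof.
elim: n => [|n IH]; first by rewrite mulr0n sin0.
by rewrite mulrSr sinDpi IH oppr0.
Qed.

Lemma integral_cos (k : int) : k != 0 ->
  \int[leb]_(x in circle R) cos (k%:~R * x) = 0.
Proof.
move=> k0; have k0' : k%:~R != 0 :> R by rewrite intr_eq0.
have dF (x : R) : is_derive x (1 : R) (fun y => k%:~R^-1 * sin (k%:~R * y))
    (cos (k%:~R * x)).
  have dsin := is_derive1_comp (is_derive_sin (k%:~R * x)) (is_derive_mulr k%:~R x).
  rewrite (_ : (fun _ => _) = (k%:~R^-1 \*: (sin \o (fun y => k%:~R * y))))//.
  by apply: is_derive_eq; rewrite /GRing.scale /= mulrCA mulVf// mulr1.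
rewrite (integral_circle_derive _ dF).
  rewrite mulrN sinN mulrN opprK mulrzl.
  have -> : sin (pi *~ k) = 0 :> R.
    case: k {k0 k0' dF} => n; first exact: sin_pi_mulrn.
    by rewrite NegzE mulrNz sinN (sin_pi_mulrn n.+1) oppr0.
  by rewrite mulr0 addr0.
move=> x; apply: continuous_comp; last exact: continuous_cos.
by apply: cvgM; [exact: cvg_cst|exact: cvg_id].
Qed.

Lemma integral_sin (k : int) :
  \int[leb]_(x in circle R) sin (k%:~R * x) = 0.
Proof.
have [->|k0] := eqVneq k 0.
  under eq_Rintegral do rewrite mul0r sin0.
  by rewrite Rintegral_cst ?mul0r//; exact: measurable_circle.
have k0' : k%:~R != 0 :> R by rewrite intr_eq0.
have dF (x : R) : is_derive x (1 : R) (fun y => - k%:~R^-1 * cos (k%:~R * y))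
    (sin (k%:~R * x)).
  have dcos := is_derive1_comp (is_derive_cos (k%:~R * x)) (is_derive_mulr k%:~R x).
  rewrite (_ : (fun _ => _) = (- k%:~R^-1 \*: (cos \o (fun y => k%:~R * y))))//.
  apply: is_derive_eq; rewrite /GRing.scale /=.
  by field.
rewrite (integral_circle_derive _ dF).
  by rewrite mulrN cosN subrr.
move=> x; apply: continuous_comp; last exact: continuous_sin.
by apply: cvgM; [exact: cvg_cst|exact: cvg_id].
Qed.

Lemma inner_expi j k :
  inner leb (@expi R j) (@expi R k) = ((j == k)%:R * (2 * pi))%:C.
Proof.
rewrite /inner.
have -> : (fun x : R => expi j x * (expi k x)^*%C) = expi (j - k).
  by apply/funext => x; rewrite expiJ -expiD.
rewrite /cintegral /expi/= integral_sin; congr (_ +i* _).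
have [->|jk] := eqVneq j k; last first.
  by rewrite mul0r integral_cos// subr_eq0.
under eq_Rintegral do rewrite subrr mul0r cos0.
rewrite Rintegral_cst; last exact: measurable_circle.
congr (_ * _); transitivity (fine (2 * pi : R)%:E) => //.
by congr fine; exact: lebesgue_circle.
Qed.

Lemma fourierE f k : fourier f k = ((2 * pi)^-1)%:C * inner leb f (@expi R k).
Proof.
congr (_ * cintegral _ _); apply/funext => x.
by rewrite expiJ mulrC.
Qed.

Lemma fourier_expi j k : fourier (@expi R j) k = (j == k)%:R.
Proof.
rewrite fourierE inner_expi -rmorphM/= mulrCA mulVf ?mulr1 ?rmorph_nat//.
by rewrite mulf_neq0// ?pnatr_eq0// gt_eqF// pi_gt0.
Qed.

Lemma fourierD f g k : L2 leb f -> L2 leb g ->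
  fourier (fun x => f x + g x) k = fourier f k + fourier g k.
Proof.
move=> f2 g2; have e2 := L2_expi k lebesgue_circle_fin.
by rewrite !fourierE innerDl// mulrDr.
Qed.

Lemma fourierZ f c k : L2 leb f -> fourier (fun x => c * f x) k = c * fourier f k.
Proof.
move=> f2; have e2 := L2_expi k lebesgue_circle_fin.
by rewrite !fourierE innerZl// mulrCA.
Qed.

Lemma fourierB f g k : L2 leb f -> L2 leb g ->
  fourier (fun x => f x - g x) k = fourier f k - fourier g k.
Proof.
move=> f2 g2; rewrite fourierD//; last exact: L2N.
have -> : (fun x => - g x) = (fun x => -1 * g x).
  by apply/funext => x; rewrite mulN1r.
by rewrite fourierZ// mulN1r.
Qed.

(** An explicit finite list, from which finiteness follows. It runs over -K, ..., K - 1, hence the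
    removal of -K; for K = 0 both sides are empty. *)
Lemma freqsE K : freqs K = [set` [seq n%:Z - K%:Z | n <- iota 0 K.*2] ] `\ (- K%:Z).
Proof.
apply/seteqP; split=> [k|k [/=]]; rewrite /freqs/=.
  move=> kK; split; last by move=> kE; move: kK; rewrite kE; lia.
  apply/mapP; exists (absz (k + K%:Z)); last by lia.
  by rewrite mem_iota; lia.
by move=> /mapP[n]; rewrite mem_iota => nK -> /eqP; lia.
Qed.

Lemma finite_freqs K : finite_set (freqs K).
Proof. by rewrite freqsE; apply: finite_setD; exact: finite_seq. Qed.

(** A duplicate-free list turns sums over a finite set into ordinary iterated sums, which admit
    induction. *)
Definition freq_seq K : seq int := finmap.enum_fset (fset_set (freqs K)).

Lemma mem_freq_seq K k : (k \in freq_seq K) = (`|k| <= K%:Z - 1).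
Proof.
rewrite /freq_seq; have := in_fset_set (finite_freqs K) k => ->.
by rewrite mem_setE.
Qed.

Lemma freq_seq_uniq K : uniq (freq_seq K).
Proof. exact: finmap.fset_uniq. Qed.

Lemma fsum_freqs (V : nmodType) K (F : int -> V) :
  \sum_(k \in freqs K) F k = \sum_(k <- freq_seq K) F k.
Proof. by rewrite fsbig_finite//; exact: finite_freqs. Qed.

(** * Trigonometric sums, their coefficients and projection onto them *)

Definition trig_sum (s : seq int) (c : int -> R[i]) : R -> R[i] :=
  fun x => \sum_(k <- s) c k * expi k x.

Lemma trigpolyP K p : trigpoly K p <-> exists c, p = trig_sum (freq_seq K) c.
Proof.
by split=> -[c ->]; exists c; apply/funext => x; rewrite fsum_freqs.
Qed.

Lemma truncationE K f : truncation K f = trig_sum (freq_seq K) (fourier f).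
Proof. by apply/funext => x; rewrite /truncation fsum_freqs. Qed.

Lemma L2_trig_sum m s c : (m (circle R) < +oo)%E -> L2 m (trig_sum s c).
Proof. by move=> moo; apply: L2_sum => // k; apply: L2Z; exact: L2_expi. Qed.

Lemma inner_trig_suml m s c g : (m (circle R) < +oo)%E -> L2 m g ->
  inner m (trig_sum s c) g = \sum_(k <- s) c k * inner m (@expi R k) g.
Proof.
move=> moo g2; have e2 k := L2_expi k moo.
rewrite inner_sum// => [|k]; last exact: L2Z.
by apply: eq_bigr => k _; rewrite innerZl.
Qed.

Lemma inner_trig_sumr m s c g : (m (circle R) < +oo)%E -> L2 m g ->
  inner m g (trig_sum s c) = \sum_(k <- s) (c k)^*%C * inner m g (@expi R k).
Proof.
move=> moo g2; have e2 k := L2_expi k moo.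
rewrite innerC//; last exact: L2_trig_sum.
rewrite inner_trig_suml// rmorph_sum/=; apply: eq_bigr => k _.
by rewrite rmorphM/= (innerC (e2 k) g2).
Qed.

Lemma fourier_trig_sum s c k : uniq s ->
  fourier (trig_sum s c) k = if k \in s then c k else 0.
Proof.
move=> us; have loo := lebesgue_circle_fin.
rewrite fourierE inner_trig_suml ?mulr_sumr//; last exact: L2_expi.
under eq_bigr do rewrite mulrCA -fourierE fourier_expi.
case: ifPn => ks.
  rewrite (bigD1_seq k)//= eqxx mulr1 big1 ?addr0// => j /negbTE jk.
  by rewrite jk mulr0.
rewrite big_seq big1// => j js; case: eqP => [jk|_]; last by rewrite mulr0.
by rewrite jk (negbTE ks) in js.
Qed.

Lemma sqnorm_trig_sum s c : uniq s ->
  sqnorm leb (trig_sum s c) = 2 * pi * \sum_(k <- s) normc (c k) ^+ 2.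
Proof.
move=> us; have loo := lebesgue_circle_fin; have p2 := L2_trig_sum s c loo.
apply: complexI; rewrite -inner_self inner_trig_sumr// rmorphM/= rmorph_sum mulr_sumr.
rewrite big_seq [RHS]big_seq; apply: eq_bigr => k ks.
have -> : inner leb (trig_sum s c) (expi k) = (2 * pi)%:C * c k.
  have := fourier_trig_sum c k us; rewrite ks fourierE => <-.
  rewrite mulrA -rmorphM/= divff ?mul1r//.
  by rewrite mulf_neq0// ?pnatr_eq0// gt_eqF// pi_gt0.
rewrite mulrCA; congr (_ * _).
rewrite normc_sqr; case: (c k) => a b; apply/eqP.
by rewrite eq_complex /=; apply/andP; split; apply/eqP; ring.
Qed.

(* Gram-Schmidt: if expi k lies in the span of expi j (j in s) up to a null
   function, then sqnorm e = 0 and division by zero makes the new coefficient 0. *)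
Lemma projection_exists m (s : seq int) f : (m (circle R) < +oo)%E -> L2 m f ->
  uniq s -> exists c : int -> R[i],
    forall k, k \in s -> inner m (fun x => f x - trig_sum s c x) (@expi R k) = 0.
Proof.
move=> moo; have e2 k := L2_expi k moo; have t2 u d := L2_trig_sum u d moo.
elim: s f => [|k s IH] f f2; first by exists (fun=> 0).
rewrite cons_uniq => /andP[ks us].
have [c cP] := IH f f2 us; have [d dP] := IH _ (e2 k) us.
set r := fun x => f x - trig_sum s c x in cP.
set e := fun x => expi k x - trig_sum s d x in dP.
have r2 : L2 m r by exact: L2B.
have ee2 : L2 m e by exact: L2B.
pose t := inner m r e / (sqnorm m e)%:C.
exists (fun j => if j == k then t else c j - t * d j).
set p := trig_sum (k :: s) _.
have pE : (fun x => f x - p x) = (fun x => r x - t * e x).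
  apply/funext => x; rewrite /p /trig_sum big_cons eqxx.
  rewrite (_ : \sum_(j <- s) _ = trig_sum s c x - t * trig_sum s d x).
    by rewrite /r /e; ring.
  rewrite /trig_sum mulr_sumr -sumrB big_seq [RHS]big_seq.
  apply: eq_bigr => j js; rewrite ifF; last first.
    by apply/negbTE; apply: contraNneq ks => <-.
  by ring.
rewrite pE => j.
have H i : i \in s -> inner m (fun x => r x - t * e x) (expi i) = 0.
  move=> si; rewrite innerBl//; last exact: L2Z.
  by rewrite innerZl// cP// dP// mulr0 subr0.
rewrite inE => /predU1P[->|]; last exact: H.
(* The frequencies in [s] are settled by [H], so orthogonality to [expi k] reduces to orthogonality
   to its residual [e], which the choice of [t] provides. *)
have -> : expi k = (fun x => e x + trig_sum s d x) :> (R -> R[i]).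
  by apply/funext => x; rewrite /e subrK.
rewrite innerDr//; last by apply: L2B => //; exact: L2Z.
rewrite inner_trig_sumr//; last by apply: L2B => //; exact: L2Z.
rewrite big_seq big1 => [|i si]; last by rewrite H// mulr0.
rewrite addr0 innerBl//; last exact: L2Z.
rewrite innerZl// inner_self /t.
have [e0|e0] := eqVneq (sqnorm m e) 0.
  by rewrite e0 mulr0 subr0 sqnorm0_inner.
by rewrite divfK ?subrr//; apply: contraNneq e0 => /complexI ->.
Qed.

(** Since a projection exists, the choice in [orthproj] satisfies its specification and the default
    value 0 is excluded. Orthogonality to each exponential extends to all trigonometric polynomials
    by conjugate linearity. *)
Lemma orthprojP m K f : (m (circle R) < +oo)%E -> L2 m f ->
  is_orthproj m K f (orthproj m K f).
Proof.
move=> moo f2; apply: (xgetPex (fun=> 0)).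
have [c cP] := projection_exists moo f2 (freq_seq_uniq K).
exists (trig_sum (freq_seq K) c); split; first by apply/trigpolyP; exists c.
move=> g /trigpolyP[d ->]; rewrite inner_trig_sumr//; last first.
  by apply: L2B => //; exact: L2_trig_sum.
by rewrite big_seq big1// => k ks; rewrite cP// mulr0.
Qed.

End trigonometric_polynomials.

(** * Density of trigonometric polynomials *)

Section density.
Variable R : realType.
Implicit Types (f g p : R -> R[i]).
Local Notation leb := (@lebesgue_measure R).
Local Notation L2 := (L2 leb).
Local Notation sqnorm := (sqnorm leb).

Definition trig p := exists K, trigpoly K p.

Lemma trigpoly_le K N p : (K <= N)%N -> trigpoly K p -> trigpoly N p.
Proof.
move=> KN /trigpolyP[c ->]; apply/trigpolyP.
exists (fun k => if k \in freq_seq K then c k else 0).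
apply/funext => x; rewrite /trig_sum.
rewrite [RHS](eq_bigr (fun k => if k \in freq_seq K then c k * expi k x else 0)); last first.
  by move=> k _; case: (k \in freq_seq K); rewrite ?mul0r.
rewrite -big_mkcond -big_filter; apply: perm_big; apply: uniq_perm.
- exact: freq_seq_uniq.
- by rewrite filter_uniq// freq_seq_uniq.
- by move=> k; rewrite mem_filter !mem_freq_seq; lia.
Qed.

Lemma trigpolyD K p g : trigpoly K p -> trigpoly K g -> trigpoly K (fun x => p x + g x).
Proof.
move=> /trigpolyP[c ->] /trigpolyP[d ->]; apply/trigpolyP; exists (fun k => c k + d k).
by apply/funext => x; rewrite -big_split/=; apply: eq_bigr => k _; rewrite mulrDl.
Qed.

Lemma trigpolyZ K p a : trigpoly K p -> trigpoly K (fun x => a * p x).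
Proof.
move=> /trigpolyP[c ->]; apply/trigpolyP; exists (fun k => a * c k).
by apply/funext => x; rewrite mulr_sumr; apply: eq_bigr => k _; rewrite mulrA.
Qed.

Lemma trigpolyB K p g : trigpoly K p -> trigpoly K g -> trigpoly K (fun x => p x - g x).
Proof.
move=> pK /(trigpolyZ (-1)) gK; have := trigpolyD pK gK.
by under eq_fun do rewrite mulN1r.
Qed.

Lemma trigD p g : trig p -> trig g -> trig (fun x => p x + g x).
Proof.
move=> [K pK] [N gN]; exists (maxn K N); apply: trigpolyD.
  by apply: trigpoly_le pK; exact: leq_maxl.
by apply: trigpoly_le gN; exact: leq_maxr.
Qed.

Lemma trigZ p a : trig p -> trig (fun x => a * p x).
Proof. by move=> [K pK]; exists K; exact: trigpolyZ. Qed.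

Lemma trig_expi k : trig (@expi R k).
Proof.
(* [trigpoly K] only reaches frequencies up to K - 1, hence the successor. *)
exists (absz k).+1; apply/trigpolyP; exists (fun j => (j == k)%:R).
apply/funext => x; rewrite /trig_sum (bigD1_seq k) ?freq_seq_uniq//=; last first.
  by rewrite mem_freq_seq; lia.
rewrite eqxx mul1r big1 ?addr0// => j /negbTE ->.
by rewrite mul0r.
Qed.

Lemma trig_cst a : trig (fun=> a).
Proof.
by have := trigZ a (trig_expi 0); under eq_fun do rewrite expi0 mulr1.
Qed.

Lemma trig_big (s : seq int) (F : int -> R -> R[i]) :
  (forall k, trig (F k)) -> trig (fun x => \sum_(k <- s) F k x).
Proof.
move=> tF; elim: s => [|k s IH].
  by under eq_fun do rewrite big_nil; exact: trig_cst.
by under eq_fun do rewrite big_cons; exact: trigD.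
Qed.

Lemma trigM p g : trig p -> trig g -> trig (fun x => p x * g x).
Proof.
move=> [K /trigpolyP[c ->]] [N /trigpolyP[d ->]].
under eq_fun do rewrite mulr_suml; apply: trig_big => j.
under eq_fun do rewrite mulr_sumr; apply: trig_big => k.
under eq_fun do rewrite mulrACA -expiD.
by apply: trigZ; exact: trig_expi.
Qed.

Lemma trig_cmeasurable p : trig p -> cmeasurable p.
Proof.
move=> [K /trigpolyP[c ->]].
by have [] := L2_trig_sum (freq_seq K) c (@lebesgue_circle_fin R).
Qed.

Lemma trig_bounded p : trig p -> exists B, forall x, normc (p x) <= B.
Proof.
move=> [K /trigpolyP[c ->]]; rewrite /trig_sum.
elim: (freq_seq K) => [|k s [B IH]].
  by exists 0 => x; rewrite big_nil normc0.
exists (normc (c k) + B) => x; rewrite big_cons (le_trans (le_normcD _ _))//.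
by rewrite lerD// normcM normc_expi mulr1.
Qed.

Lemma trig_L2 p : trig p -> L2 p.
Proof.
move=> tp; have [B pB] := trig_bounded tp.
exact: (L2_bounded (@lebesgue_circle_fin R) (trig_cmeasurable tp) pB).
Qed.

(** * The L^2-closure of the trigonometric polynomials *)

Lemma sqnorm_le_scale f g B : L2 f -> L2 g ->
  (forall x, circle R x -> normc (f x) ^+ 2 <= B * normc (g x) ^+ 2) ->
  sqnorm f <= B * sqnorm g.
Proof.
move=> [_ f2] [_ g2] fg; rewrite /sqnorm -RintegralZl//; last exact: measurable_circle.
apply: le_Rintegral => //; first exact: measurable_circle.
exact: (integrableZl (@measurable_circle R) B g2).
Qed.

(** A triangle inequality for squared norms, which avoids square roots. Its factors 2 are the reason
    why errors are split below into two pieces of size e / 4. *)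
Lemma sqnormD_le f g : L2 f -> L2 g ->
  sqnorm (fun x => f x + g x) <= 2 * sqnorm f + 2 * sqnorm g.
Proof.
move=> f2 g2; have [_ fg] := L2D f2 g2; move: f2 g2 => [_ f2] [_ g2].
have mc := @measurable_circle R.
have Z (u : R -> R) : leb.-integrable (circle R) (fun x => (u x)%:E) ->
    leb.-integrable (circle R) (fun x => (2 * u x)%:E).
  by move=> ui; under eq_fun do rewrite EFinM; apply: integrableZl.
rewrite /sqnorm -!RintegralZl// -RintegralD//; [|exact: Z..].
apply: le_Rintegral => //.
  exact: (integrableD mc (Z _ f2) (Z _ g2)).
by move=> x _; exact: normc_sqrD.
Qed.

Definition trig_approx f :=
  L2 f /\ forall e, 0 < e -> exists2 t, trig t & sqnorm (fun x => f x - t x) <= e.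

Lemma sqnorm0 : sqnorm (fun=> 0) = 0.
Proof.
rewrite /sqnorm; under eq_Rintegral do rewrite normc0 expr0n.
by rewrite Rintegral_cst ?mul0r//; exact: measurable_circle.
Qed.

Lemma trig_approx_trig t : trig t -> trig_approx t.
Proof.
move=> tt; split=> [|e e0]; first exact: trig_L2.
exists t => //; under [X in sqnorm X]eq_fun do rewrite subrr.
by rewrite sqnorm0 ltW.
Qed.

Lemma trig_approx_lim f : L2 f ->
  (forall e, 0 < e -> exists2 g, trig_approx g & sqnorm (fun x => f x - g x) <= e) ->
  trig_approx f.
Proof.
move=> f2 fg; split=> // e e0.
have e4 : 0 < e / 4 by rewrite divr_gt0.
have [g [g2 gt] fge] := fg _ e4; have [t tt gte] := gt _ e4.
exists t => //; have t2 := trig_L2 tt.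
have := sqnormD_le (L2B f2 g2) (L2B g2 t2).
under [X in sqnorm X <= _]eq_fun do rewrite addrA subrK.
by move=> /le_trans; apply; lra.
Qed.

Lemma trig_approxD f g : trig_approx f -> trig_approx g ->
  trig_approx (fun x => f x + g x).
Proof.
move=> [f2 ft] [g2 gt]; split=> [|e e0]; first exact: L2D.
have e4 : 0 < e / 4 by rewrite divr_gt0.
have [s ts fs] := ft _ e4; have [t tt gt'] := gt _ e4.
exists (fun x => s x + t x); first exact: trigD.
have := sqnormD_le (L2B f2 (trig_L2 ts)) (L2B g2 (trig_L2 tt)).
under [X in sqnorm X <= _]eq_fun do rewrite addrACA -opprD.
by move=> /le_trans; apply; lra.
Qed.

(** Write f g - s t = (f - s) g + (g - t) s. First s is chosen according to the bound B on g, and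
    only then t according to a bound C on s. *)
Lemma trig_approxM f g B : trig_approx f -> trig_approx g ->
  (forall x, normc (g x) <= B) -> trig_approx (fun x => f x * g x).
Proof.
move=> [f2 ft] [g2 gt] gB; have mg := g2.1; split=> [|e e0].
  exact: L2_bounded_mul gB.
have B0 : 0 <= B by rewrite (le_trans (normc_ge0 _) (gB 0)).
(* The summand 1 keeps the denominator positive when B = 0. *)
have B20 : 0 < 4 * (B ^+ 2 + 1) by rewrite mulr_gt0// ltr_wpDl// sqr_ge0.
have [s ts fs] := ft (e / (4 * (B ^+ 2 + 1))) (divr_gt0 e0 B20).
have [C sC] := trig_bounded ts; have ms := trig_cmeasurable ts.
have C20 : 0 < 4 * (C ^+ 2 + 1) by rewrite mulr_gt0// ltr_wpDl// sqr_ge0.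
have [t tt gt'] := gt (e / (4 * (C ^+ 2 + 1))) (divr_gt0 e0 C20).
exists (fun x => s x * t x); first exact: trigM.
have fs2 : L2 (fun x => f x - s x) by apply: L2B => //; exact: trig_L2.
have gt2 : L2 (fun x => g x - t x) by apply: L2B => //; exact: trig_L2.
have u2 : L2 (fun x => (f x - s x) * g x) by exact: L2_bounded_mul gB.
have v2 : L2 (fun x => (g x - t x) * s x) by exact: L2_bounded_mul sC.
have := sqnormD_le u2 v2.
rewrite (_ : (fun x => _ + _) = (fun x => f x * g x - s x * t x)); last first.
  by apply/funext => x; ring.
move=> /le_trans; apply.
have bound (u v : R -> R[i]) (D : R) : L2 u -> L2 (fun x => u x * v x) ->
    (forall x, normc (v x) <= D) -> sqnorm u <= e / (4 * (D ^+ 2 + 1)) ->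
    sqnorm (fun x => u x * v x) <= e / 4.
  move=> uu uv vD ue; have D0 : 0 <= D by rewrite (le_trans (normc_ge0 _) (vD 0)).
  have /le_trans : sqnorm (fun x => u x * v x) <= D ^+ 2 * sqnorm u.
    apply: sqnorm_le_scale => // x _; rewrite normcM exprMn mulrC.
    by rewrite ler_wpM2r ?sqr_ge0// ler_sqr ?nnegrE ?normc_ge0.
  apply; have D2 : 0 < D ^+ 2 + 1 by rewrite ltr_wpDl// sqr_ge0.
  apply: (@le_trans _ _ ((D ^+ 2 + 1) * sqnorm u)).
    by rewrite ler_wpM2r ?sqnorm_ge0// lerDl.
  move: ue; rewrite invfM mulrA ler_pdivlMr// => ue.
  by rewrite mulrC.
have := bound _ _ _ fs2 u2 gB fs; have := bound _ _ _ gt2 v2 sC gt'.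
by lra.
Qed.

Lemma trig_approxZ f a : trig_approx f -> trig_approx (fun x => a * f x).
Proof.
move=> ft; under eq_fun do rewrite mulrC.
have at_ := trig_approx_trig (trig_cst a).
exact: (trig_approxM (B := normc a)).
Qed.

Lemma trig_approxX f n : trig_approx f -> (exists B, forall x, normc (f x) <= B) ->
  trig_approx (fun x => f x ^+ n).
Proof.
move=> ft [B fB]; elim: n => [|n IH].
  by under eq_fun do rewrite expr0; apply: trig_approx_trig; exact: trig_cst.
by under eq_fun do rewrite exprSr; exact: trig_approxM fB.
Qed.

(** Dominated convergence is applied to the squared errors |f - u_n|^2 rather than to u_n, so their
    integrals tend to 0 and some [u N] is close enough to f in L^2. *)
Lemma trig_approx_dominated (u : (R -> R[i])^nat) f (G : R -> R) :
  (forall n, trig_approx (u n)) -> L2 f ->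
  leb.-integrable (circle R) (fun x => (G x)%:E) ->
  (forall n x, circle R x -> normc (f x - u n x) ^+ 2 <= G x) ->
  {ae leb, forall x, circle R x ->
    (fun n => normc (f x - u n x) ^+ 2) @ \oo --> (0 : R)} ->
  trig_approx f.
Proof.
move=> ut f2 iG fG cv; apply: trig_approx_lim => // e e0.
have d2 n : L2 (fun x => f x - u n x) by apply: L2B => //; case: (ut n).
have mc := @measurable_circle R.
have cv0 : \forall x \ae leb, circle R x ->
    (fun n => (normc (f x - u n x) ^+ 2)%:E) @ \oo --> (cst 0%:E x : \bar R).
  apply: negligibleS cv => x; apply: contra_not => h Dx; apply: cvg_EFin; first exact: nearW.
  exact: h.
have dom : \forall x \ae leb, forall n, circle R x ->
    (`|(normc (f x - u n x) ^+ 2)%:E| <= (G x)%:E)%E.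
  by apply: aeW => x n Dx; rewrite lee_fin ger0_norm ?sqr_ge0// fG.
have [_ _] := @dominated_convergence _ _ R leb (circle R) mc
  (fun n x => (normc (f x - u n x) ^+ 2)%:E) (cst 0%:E) (fun x => (G x)%:E)
  (fun n => measurable_int leb (d2 n).2) (measurable_cst _) cv0 iG dom.
rewrite integral0.
move=> /fine_cvgP[_] /cvgr0_norm_le /(_ e e0)[N _ /(_ N (leqnn N))] /= h.
exists (u N) => //; exact: le_trans (ler_norm _) h.
Qed.

Definition cindic (A : set R) : R -> R[i] := fun x => (\1_A x)%:C.

Lemma cmeasurable_real (v : R -> R) : measurable_fun [set: R] v ->
  cmeasurable (fun x => (v x)%:C).
Proof. by move=> mv; split => //=; exact: measurable_cst. Qed.

Lemma normc_real (a : R) : normc a%:C = `|a|.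
Proof. by rewrite /= expr0n addr0 sqrtr_sqr. Qed.

Lemma normc_realB (a b : R) : normc (a%:C - b%:C) ^+ 2 = (a - b) ^+ 2.
Proof. by rewrite -rmorphB normc_real real_normK ?num_real. Qed.

Lemma normc_cindic A x : normc (cindic A x) <= 1.
Proof.
by rewrite normc_real indicE ger0_norm// lern1 leq_b1.
Qed.

(** For values in [0, 1] the constant 1 dominates the squared errors. The null set [Z] absorbs the
    boundary points of an arc, where the approximants used later need not converge to the
    indicator. *)
Lemma trig_approx_bounded_cvg (u : (R -> R)^nat) (v : R -> R) (Z : set R) :
  (forall n, trig_approx (fun x => (u n x)%:C)) -> measurable_fun [set: R] v ->
  (forall n x, circle R x -> 0 <= u n x <= 1) -> (forall x, 0 <= v x <= 1) ->
  leb.-negligible Z ->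
  (forall x, circle R x -> ~ Z x -> (fun n => u n x) @ \oo --> v x) ->
  trig_approx (fun x => (v x)%:C).
Proof.
move=> ut mv u01 v01 Z0 cv; apply: (trig_approx_dominated (G := cst 1) ut).
- apply: (L2_bounded (B := 1) (@lebesgue_circle_fin R)); first exact: cmeasurable_real.
  by move=> x; rewrite normc_real; have /andP[? ?] := v01 x; rewrite ger0_norm.
- apply/integrableP; split; first by apply/measurable_EFinP; exact: measurable_cst.
  under eq_integral do rewrite /cst/= normr1.
  rewrite (@integral_cst _ _ _ leb _ (@measurable_circle R) 1%:E) mul1e.
  exact: lebesgue_circle_fin.
- move=> n x Dx; rewrite normc_realB.
  have /andP[? ?] := v01 x; have /andP[? ?] := u01 n x Dx.
  by rewrite /cst/= expr2; nra.
- apply: negligibleS Z0 => x /= h; apply: contrapT => nZ; apply: h => Dx.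
  rewrite [X in X @ _](_ : _ = (fun n => (v x - u n x) ^+ 2)); last first.
    by apply/funext => n; exact: normc_realB.
  rewrite (_ : 0 = (v x - v x) ^+ 2); last by rewrite subrr expr0n.
  have h : (fun n => v x - u n x) @ \oo --> v x - v x.
    by apply: cvgB; [exact: cvg_cst|exact: cv].
  by rewrite expr2; under eq_fun do rewrite expr2; exact: cvgM.
Qed.

(** * Bernoulli's inequality and the approximation of indicators of arcs *)

Lemma bernoulli_le (x : R) n : -1 <= x -> 1 + x *+ n <= (1 + x) ^+ n.
Proof.
move=> x1; elim: n => [|n IH]; first by rewrite mulr0n addr0 expr0.
have n0 : 0 <= n%:R :> R by rewrite ler0n.
rewrite exprS; apply: (@le_trans _ _ ((1 + x) * (1 + x *+ n))).
  by rewrite mulrSr -mulr_natr; nra.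
by rewrite ler_wpM2l//; lra.
Qed.

(** Bernoulli gives (1 - s^n)^(2^n) >= 1 - (2 s)^n, and 2 s < 1. *)
Lemma bernstein_cvg1 (s : R) : 0 <= s -> s < 2^-1 ->
  (fun n => (1 - s ^+ n) ^+ (2 ^ n)) @ \oo --> (1 : R).
Proof.
move=> s0 s1.
have c : (fun n => 1 - (2 * s) ^+ n) @ \oo --> (1 - 0 : R).
  apply: cvgB; first exact: cvg_cst.
  apply: cvg_expr; rewrite ger0_norm; last by rewrite mulr_ge0.
  by rewrite mulrC -ltr_pdivlMr// mul1r.
rewrite subr0 in c; apply: (squeeze_cvgr _ c); last exact: cvg_cst.
near=> n.
have sn1 : s ^+ n <= 1 by apply: exprn_ile1 => //; lra.
have sn0 : 0 <= s ^+ n by apply: exprn_ge0.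
apply/andP; split; last by apply: exprn_ile1; lra.
have := @bernoulli_le (- s ^+ n) (2 ^ n); rewrite mulNrn -[X in _ - X]mulr_natl natrX -exprMn.
by apply; lra.
Unshelve. all: by end_near. Qed.

(** Multiplied by (1 + s^n)^(2^n), the sequence becomes (1 - s^(2n))^(2^n) <= 1, while Bernoulli
    bounds the multiplier below by (2 s)^n. So the sequence is at most (2 s)^(-n), with 2 s > 1. *)
Lemma bernstein_cvg0 (s : R) : 2^-1 < s -> s <= 1 ->
  (fun n => (1 - s ^+ n) ^+ (2 ^ n)) @ \oo --> (0 : R).
Proof.
move=> s0 s1; have s20 : 1 < 2 * s by rewrite mulrC -ltr_pdivrMr// mul1r.
have c : (fun n => (2 * s)^-1 ^+ n) @ \oo --> (0 : R).
  apply: cvg_expr; rewrite ger0_norm; last by rewrite invr_ge0; lra.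
  by rewrite invf_lt1//; lra.
apply: (squeeze_cvgr _ _ c); last exact: cvg_cst.
near=> n.
have sn1 : s ^+ n <= 1 by apply: exprn_ile1 => //; lra.
have sn0 : 0 <= s ^+ n by apply: exprn_ge0; lra.
apply/andP; split; first by apply: exprn_ge0; lra.
rewrite exprVn -[leRHS]mul1r ler_pdivlMr; last by apply: exprn_gt0; lra.
have h1 : (2 * s) ^+ n <= (1 + s ^+ n) ^+ (2 ^ n).
  apply: le_trans (@bernoulli_le (s ^+ n) (2 ^ n) _); last by lra.
  by rewrite -[X in _ + X]mulr_natl natrX exprMn; lra.
have p0 : 0 <= (1 - s ^+ n) ^+ (2 ^ n) by apply: exprn_ge0; lra.
apply: le_trans (ler_wpM2l p0 h1) _; rewrite -exprMn.
by apply: exprn_ile1; nra.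
Unshelve. all: by end_near. Qed.

Lemma trig_cosB (x0 : R) : trig (fun x => (cos (x - x0))%:C).
Proof.
rewrite (_ : (fun _ => _) =
    (fun x => 2^-1 * expi (-1) x0 * expi 1 x + 2^-1 * expi 1 x0 * expi (-1) x)).
  by apply: trigD; apply: trigZ; exact: trig_expi.
apply/funext => x; rewrite cosB /expi !mulN1r !mul1r !cosN !sinN.
rewrite (_ : 2^-1 = (2^-1 : R)%:C); last by rewrite fmorphV rmorph_nat.
by apply/eqP; rewrite eq_complex /=; apply/andP; split; apply/eqP; field.
Qed.

(* For a in [-pi, pi[, the trace of the ray on the circle is, up to the null set
   {a, pi}, the arc where cos (x - x0) > cos d, i.e. where s x < 1/2. *)
Lemma trig_approx_ray (a : R) : trig_approx (cindic `]a, +oo[).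
Proof.
have v01 (x : R) : 0 <= (\1_`]a, +oo[ x : R) <= 1.
  by rewrite indicE ler0n lern1 leq_b1.
have mv : measurable_fun [set: R] (\1_`]a, +oo[ : R -> R).
  by apply: measurable_indic; exact: measurable_itv.
have npi : - pi < pi :> R by rewrite gtrN ?pi_gt0.
have pi0 := pi_gt0 R.
(* For a >= pi the ray misses the circle and the zero approximants do; for a < - pi, treated next,
   it contains the circle and the approximants are 1. *)
have [api|pia] := ltP a pi; last first.
  apply: (@trig_approx_bounded_cvg (fun _ _ => 0) _ set0) => //.
  - by move=> n; apply: trig_approx_trig; exact: trig_cst.
  - by move=> n x _; rewrite lexx ler01.
  - exact: negligible_set0.
  - move=> x; rewrite /circle/= in_itv/= => /andP[_ xpi] _.
    rewrite indicE (_ : (x \in _) = false); first exact: cvg_cst.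
    by apply/negbTE; rewrite notin_setE/= in_itv/= andbT; apply/negP; rewrite -leNgt; lra.
have [pia|api'] := ltP a (- pi).
  apply: (@trig_approx_bounded_cvg (fun _ _ => 1) _ set0) => //.
  - by move=> n; apply: trig_approx_trig; exact: trig_cst.
  - by move=> n x _; rewrite lexx ler01.
  - exact: negligible_set0.
  - move=> x; rewrite /circle/= in_itv/= => /andP[xpi _] _.
    rewrite indicE (_ : (x \in _) = true); first exact: cvg_cst.
    by apply/mem_set; rewrite /= in_itv/= andbT; lra.
(* Midpoint and half-length of the arc from [a] to [pi]. *)
pose x0 := (a + pi) / 2; pose d := (pi - a) / 2.
(* Two cosines differ by at most 2, so dividing by 4 keeps [s] within [0, 1]. *)
pose s x : R := 2^-1 - (cos (x - x0) - cos d) / 4.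
have s01 x : 0 <= s x <= 1.
  have := cos_geN1 (x - x0); have := cos_le1 (x - x0).
  have := cos_geN1 d; have := cos_le1 d; rewrite /s; lra.
have st : trig (fun x => (s x)%:C).
  rewrite (_ : (fun _ => _) = (fun x => (2^-1 + cos d / 4)%:C + (- 4^-1)%:C * (cos (x - x0))%:C)).
    by apply: trigD; [exact: trig_cst|apply: trigZ; exact: trig_cosB].
  by apply/funext => x; rewrite -rmorphM -rmorphD/=; congr (_%:C); rewrite /s; field.
have bdd (v : R -> R) : (forall x, 0 <= v x <= 1) ->
    exists B, forall x, normc (v x)%:C <= B.
  by move=> v1; exists 1 => x; have /andP[? ?] := v1 x; rewrite normc_real ger0_norm.
have sn01 n x : 0 <= 1 - s x ^+ n <= 1.
  have /andP[? ?] := s01 x.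
  by rewrite subr_ge0 exprn_ile1//= lerBlDr lerDl exprn_ge0.
apply: (@trig_approx_bounded_cvg (fun n x => (1 - s x ^+ n) ^+ (2 ^ n)) _
  ([set a] `|` [set pi])) => //.
- move=> n; under eq_fun do rewrite rmorphXn/=.
  apply: trig_approxX; last exact: bdd.
  under eq_fun do rewrite rmorphB/= -mulN1r; apply: trig_approxD.
    by apply: trig_approx_trig; exact: trig_cst.
  apply: trig_approxZ; under eq_fun do rewrite rmorphXn/=.
  by apply: trig_approxX; [exact: trig_approx_trig|exact: bdd].
- by move=> n x _; have /andP[? ?] := sn01 n x; rewrite exprn_ge0//= exprn_ile1.
- apply: negligibleU; apply/negligibleP => //; exact: lebesgue_measure_set1.
move=> x; rewrite /circle/= in_itv/= => /andP[pix xpi] /not_orP[/eqP xa /eqP xpi'].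
have xltpi : x < pi by rewrite lt_neqAle xpi'.
have /andP[? ?] := s01 x.
have d0pi : d \in `[0, pi] by rewrite in_itv/= /d; apply/andP; split; lra.
have cosE : cos (x - x0) = cos `|x - x0| by case: (ler0P (x - x0)) => _; rewrite ?cosN.
move: xa; rewrite neq_lt => /orP[xa|ax].
  rewrite indicE (_ : (x \in _) = false); last first.
    by apply/negbTE; rewrite notin_setE/= in_itv/= andbT; apply/negP; rewrite -leNgt ltW.
  apply: bernstein_cvg0 => //; rewrite /s.
  suff : cos (x - x0) < cos d by lra.
  have xx0 : x - x0 < - d by rewrite /x0 /d; lra.
  (* Cosine decreases only on [0, pi]. When x0 - x exceeds pi it is replaced by 2 pi - (x0 - x),
     which is larger than d because x0 + d = pi and x > - pi. *)
  have [h|h] := leP (x0 - x) pi.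
    rewrite -cosN ltr_cos//; first by lra.
    by rewrite in_itv/=; move: d0pi; rewrite in_itv/= => /andP[? ?]; apply/andP; split; lra.
  have -> : cos (x - x0) = cos (pi *+ 2 - (x0 - x)).
    by rewrite -cosN (_ : - (_ - _) = x0 - x) ?cosB ?cos2pi ?sin2pi; ring.
  rewrite ltr_cos//; first by rewrite mulr2n /x0 /d; lra.
  have x0pi : x0 < pi by rewrite /x0; lra.
  by rewrite in_itv/= mulr2n; apply/andP; split; lra.
rewrite indicE (_ : (x \in _) = true); last first.
  by apply/mem_set; rewrite /= in_itv/= andbT.
apply: bernstein_cvg1 => //; rewrite /s.
suff : cos d < cos (x - x0) by lra.
have xx0 : `|x - x0| < d by rewrite ltr_norml /x0 /d; apply/andP; split; lra.
rewrite cosE ltr_cos//.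
by rewrite in_itv/= normr_ge0/=; move: d0pi; rewrite in_itv/= => /andP[? ?]; lra.
Qed.

(** The good sets [G] are closed under complement (subtract from 1), intersection (multiply) and
    countable union (pointwise limit of finite unions), and the open rays generate the Borel sets.
    Measurability is kept in [G] because the limit step asks for a measurable limit. *)
Lemma trig_approx_cindic (A : set R) : measurable A -> trig_approx (cindic A).
Proof.
pose G := [set A : set R | measurable A /\ trig_approx (cindic A)].
move=> mA; suff : (@ocitv R).-sigma.-measurable `<=` G by move=> /(_ _ mA)[].
rewrite RGenOInfty.measurableE; apply: smallest_sub; last first.
  move=> _ [x ->]; split; [exact: measurable_itv|exact: trig_approx_ray].
have Gcompl B : G B -> G (~` B).
  move=> [mB tB]; split; first exact: measurableC.
  rewrite (_ : cindic _ = (fun x => 1 + (-1) * cindic B x)).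
    apply: trig_approxD; last exact: trig_approxZ.
    by apply: trig_approx_trig; exact: trig_cst.
  apply/funext => x; rewrite /cindic !indicE in_setC mulN1r.
  by case: (x \in B); rewrite /= ?subr0// subrr.
have GI B C : G B -> G C -> G (B `&` C).
  move=> [mB tB] [mC tC]; split; first exact: measurableI.
  rewrite (_ : cindic _ = (fun x => cindic B x * cindic C x)).
    by apply: (trig_approxM (B := 1)) => //; exact: normc_cindic.
  by apply/funext => x; rewrite /cindic -rmorphM/= !indicE in_setI -natrM mulnb.
have G0 : G set0.
  split => //; rewrite (_ : cindic _ = fun=> 0).
    by apply: trig_approx_trig; exact: trig_cst.
  by apply/funext => x; rewrite /cindic indic0.
split => //.
  by move=> B GB; rewrite setTD; exact: Gcompl.
move=> F GF; have mF : measurable (\bigcup_k F k).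
  by apply: bigcupT_measurable => k; case: (GF k).
split => //.
have GFn n : G (\big[setU/set0]_(k < n) F k).
  elim: n => [|n IH]; first by rewrite big_ord0.
  (* De Morgan: finite unions come from complements and intersections. *)
  rewrite big_ord_recr /= -[X in G X]setCK setCU.
  by apply: (Gcompl _ _); apply: (GI _ _ _ _); exact: (Gcompl _ _).
apply: (@trig_approx_bounded_cvg (fun n => \1_(\big[setU/set0]_(k < n) F k)) _ set0).
- by move=> n; case: (GFn n).
- exact: measurable_indic.
- by move=> n x _; rewrite indicE ler0n lern1 leq_b1.
- by move=> x; rewrite indicE ler0n lern1 leq_b1.
- exact: negligible_set0.
(* At each point the indicators of the partial unions are eventually constant. *)
- move=> x _ _; have [[k _ Fkx]|nF] := pselect ((\bigcup_k F k) x).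
    apply: cvg_near_cst; exists k.+1 => // n /= kn.
    rewrite !indicE mem_set; last by rewrite -bigcup_mkord; exists k.
    by rewrite mem_set//; exists k.
  apply: cvg_near_cst; apply: nearW => n.
  rewrite !indicE memNset; last first.
    by rewrite -bigcup_mkord => -[k _ Fk]; apply: nF; exists k.
  by rewrite memNset.
Qed.

(** * From indicators through simple functions to all of L^2 *)

Import HBNNSimple.

Lemma trig_approx_nnsfun (g : {nnsfun R >-> R}) : trig_approx (fun x => (g x)%:C).
Proof.
rewrite (_ : (fun _ => _) = (fun x => \sum_(y <- finmap.enum_fset (fset_set (range g)))
    y%:C * cindic (g @^-1` [set y]) x)); last first.
  apply/funext => x; rewrite [in LHS](fimfunE g) fsbig_finite//=.
  by rewrite rmorph_sum; apply: eq_bigr => y _; rewrite rmorphM.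
elim: (finmap.enum_fset _) => [|y s IH].
  by under eq_fun do rewrite big_nil; apply: trig_approx_trig; exact: trig_cst.
under eq_fun do rewrite big_cons; apply: trig_approxD => //.
by apply: trig_approxZ; apply: trig_approx_cindic; exact: measurable_funPTI.
Qed.

(** Simple functions 0 <= g_n <= v converge to v, and (v - g_n)^2 is dominated by the integrable
    function v^2. *)
Lemma trig_approx_ge0 (v : R -> R) : (forall x, 0 <= v x) -> L2 (fun x => (v x)%:C) ->
  trig_approx (fun x => (v x)%:C).
Proof.
move=> v0 v2; have mv : measurable_fun [set: R] v by case: v2 => -[].
have mEv : measurable_fun [set: R] (EFin \o v) by exact/measurable_EFinP.
pose g := nnsfun_approx measurableT mEv.
have gv n x : g n x <= v x.
  rewrite -lee_fin /g nnsfun_approxE; apply: le_approx => // y _.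
  by rewrite /= lee_fin.
apply: (@trig_approx_dominated (fun n x => (g n x)%:C) _ (fun x => normc (v x)%:C ^+ 2)).
- by move=> n; exact: trig_approx_nnsfun.
- by [].
- by case: v2.
- move=> n x _; rewrite normc_realB normc_real real_normK ?num_real//.
  have g0 : 0 <= g n x by [].
  by have := gv n x; rewrite !expr2; nra.
- apply: aeW => x _.
  have cg : (fun n => g n x) @ \oo --> v x.
    have := @cvg_nnsfun_approx _ _ R _ measurableT _ mEv _ x Logic.I.
    have h0 : forall x : R, [set: R] x -> (0 <= (EFin \o v) x)%E.
      by move=> y _; rewrite /= lee_fin.
    by move=> /(_ h0) /fine_cvgP[].
  rewrite [X in X @ _](_ : _ = (fun n => (v x - g n x) * (v x - g n x))); last first.
    by apply/funext => n; rewrite normc_realB expr2.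
  rewrite (_ : 0 = (v x - v x) * (v x - v x)); last by rewrite subrr mul0r.
  have h : (fun n => v x - g n x) @ \oo --> v x - v x.
    by apply: cvgB; [exact: cvg_cst|exact: cg].
  exact: cvgM.
Qed.

Lemma trig_approx_real (v : R -> R) : L2 (fun x => (v x)%:C) ->
  trig_approx (fun x => (v x)%:C).
Proof.
move=> v2; have mv : measurable_fun [set: R] v by case: v2 => -[].
rewrite (_ : (fun _ => _) = (fun x => (v^\+ x)%:C + (-1) * (v^\- x)%:C)).
  apply: trig_approxD; last apply: trig_approxZ.
    apply: trig_approx_ge0; first by move=> x; exact: funrpos_ge0.
    apply: L2_le v2 _; first by apply: cmeasurable_real; exact: measurable_funrpos.
    move=> x; rewrite !normc_real !real_normK ?num_real// /funrpos.
    by case: (leP (v x) 0) => h; rewrite ?expr0n ?sqr_ge0.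
  apply: trig_approx_ge0; first by move=> x; exact: funrneg_ge0.
  apply: L2_le v2 _; first by apply: cmeasurable_real; exact: measurable_funrneg.
  move=> x; rewrite !normc_real !real_normK ?num_real// /funrneg.
  by case: (leP (- v x) 0) => h; rewrite ?expr0n ?sqr_ge0 ?sqrrN.
apply/funext => x; rewrite mulN1r -rmorphB/=; congr (_%:C).
by rewrite -[in LHS](funrposBneg v).
Qed.

(** Density: real and imaginary parts are square-integrable, being dominated by f, and are
    approximated separately. *)
Lemma trig_approxP f : L2 f -> trig_approx f.
Proof.
move=> f2; have [[m1 m2] _] := f2.
rewrite (_ : f = (fun x => (complex.Re (f x))%:C + 'i%C * (complex.Im (f x))%:C)).
  apply: trig_approxD; last apply: trig_approxZ.
    apply: trig_approx_real; apply: L2_le f2 _; first exact: cmeasurable_real.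
    by move=> x; rewrite normc_real real_normK ?num_real// normc_sqr lerDl sqr_ge0.
  apply: trig_approx_real; apply: L2_le f2 _; first exact: cmeasurable_real.
  by move=> x; rewrite normc_real real_normK ?num_real// normc_sqr lerDr sqr_ge0.
by apply/funext => x; exact: complexE.
Qed.

End density.

(** * Projection errors *)

Section projection_error.
Variable R : realType.
Implicit Types (f g p r : R -> R[i]) (m : {measure set (measurableTypeR R) -> \bar R}).
Local Notation leb := (@lebesgue_measure R).

(** In f - t = (f - p) + (p - t) the second term is a trigonometric polynomial of the same degree,
    hence orthogonal to the first; Pythagoras concludes. *)
Lemma best_approximation m K f p t : (m (circle R) < +oo)%E -> L2 m f ->
  is_orthproj m K f p -> trigpoly K t ->
  sqnorm m (fun x => f x - p x) <= sqnorm m (fun x => f x - t x).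
Proof.
move=> moo f2 [pK fp] tK.
have L2K g : trigpoly K g -> L2 m g.
  by move=> /trigpolyP[c ->]; exact: L2_trig_sum.
rewrite (_ : (fun x => f x - t x) = (fun x => (f x - p x) + (p x - t x))).
  have fp2 : L2 m (fun x => f x - p x) by apply: (L2B f2); exact: L2K.
  have pt2 : L2 m (fun x => p x - t x) by apply: L2B; exact: L2K.
  have fpt := fp _ (trigpolyB pK tK).
  by rewrite [leRHS]sqnorm_pythagoras// lerDl sqnorm_ge0.
by apply/funext => x; rewrite addrA subrK.
Qed.

Lemma fourier_truncation K f k :
  fourier (truncation K f) k = if k \in freq_seq K then fourier f k else 0.
Proof. by rewrite truncationE fourier_trig_sum// freq_seq_uniq. Qed.

Lemma L2_truncation m K f : (m (circle R) < +oo)%E -> L2 m (truncation K f).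
Proof. by move=> moo; rewrite truncationE; exact: L2_trig_sum. Qed.

Lemma trigpoly_truncation K f : trigpoly K (truncation K f).
Proof. by apply/trigpolyP; exists (fourier f); rewrite truncationE. Qed.

(** Makes best approximation in Lebesgue measure available for D_K: the residual has vanishing
    coefficients below K. *)
Lemma truncation_is_orthproj K f : L2 leb f -> is_orthproj leb K f (truncation K f).
Proof.
move=> f2; have loo := @lebesgue_circle_fin R; have t2 := L2_truncation K f loo.
have d2 : L2 leb (fun x => f x - truncation K f x) by exact: L2B.
split; first exact: trigpoly_truncation.
move=> g /trigpolyP[c ->]; rewrite inner_trig_sumr//.
rewrite big_seq big1// => k kK; have := fourierB k f2 t2.
rewrite fourier_truncation kK subrr fourierE => /eqP; rewrite mulf_eq0 => /orP[|/eqP->].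
  move=> /eqP/complexI/eqP; rewrite invr_eq0 mulf_eq0 pnatr_eq0/=.
  by rewrite gt_eqF// pi_gt0.
by rewrite mulr0.
Qed.

Lemma bessel K f : L2 leb f -> sqnorm leb f =
  sqnorm leb (fun x => f x - truncation K f x) +
  2 * pi * \sum_(k <- freq_seq K) normc (fourier f k) ^+ 2.
Proof.
move=> f2; have loo := @lebesgue_circle_fin R; have t2 := L2_truncation K f loo.
have [tK ft] := truncation_is_orthproj K f2.
rewrite -(sqnorm_trig_sum (fourier f) (freq_seq_uniq K)) -truncationE.
rewrite -sqnorm_pythagoras//; last 2 first.
- exact: L2B.
- exact: ft.
by congr (sqnorm leb _); apply/funext => x; rewrite subrK.
Qed.

(** Density gives a trigonometric polynomial within e of f. Truncation at its degree is at least as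
    good, and by Bessel's identity the rest of |f|^2 is a finite partial sum of the series. *)
Lemma parseval_le f : L2 leb f -> ((sqnorm leb f)%:E <=
  (2 * pi)%:E * \esum_(k in [set: int]) (normc (fourier f k) ^+ 2)%:E)%E.
Proof.
move=> f2; apply/lee_addgt0Pr => e e0.
have [_ /(_ e e0)[t [K tK] fte]] := trig_approxP f2.
have loo := @lebesgue_circle_fin R.
have := best_approximation loo f2 (truncation_is_orthproj K f2) tK.
move=> /le_trans/(_ fte) h; rewrite (bessel K f2) addrC EFinD leeD//.
rewrite EFinM lee_wpmul2l ?lee_fin ?mulr_ge0 ?pi_ge0//.
rewrite -fsum_freqs -fsumEFin; last exact: finite_freqs.
apply: esum_ge; exists (freqs K) => //; split => //; exact: finite_freqs.
Qed.

Lemma sqnorm_le_measure (m1 m2 : {measure set (measurableTypeR R) -> \bar R})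
    f (M : R) : 0 < M -> L2 m2 f ->
  (forall S, measurable S -> S `<=` circle R -> (m1 S <= M%:E * m2 S)%E) ->
  L2 m1 f /\ sqnorm m1 f <= M * sqnorm m2 f.
Proof.
move=> M0 f2 m12; have mc := @measurable_circle R; have mf := f2.1.
have mF : measurable_fun [set: R] (fun x => (normc (f x) ^+ 2)%:E).
  by apply/measurable_EFinP; exact: cmeasurable_normc_sqr.
have F0 x : (0 <= (normc (f x) ^+ 2)%:E)%E by rewrite lee_fin sqr_ge0.
(* The comparison of measures is known only inside the circle, while monotonicity of the integral in
   the measure wants it on all measurable sets; restricting both measures bridges this. *)
have restr (m : {measure set (measurableTypeR R) -> \bar R}) :
    (\int[m]_(x in circle R) (normc (f x) ^+ 2)%:E =
     \int[mrestr m mc]_(x in circle R) (normc (f x) ^+ 2)%:E)%E.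
  by apply: eq_measure_integral => S mS SD; rewrite -[in LHS](setIidl SD).
have le : (\int[m1]_(x in circle R) (normc (f x) ^+ 2)%:E <= (M * sqnorm m2 f)%:E)%E.
  rewrite EFinM -sqnormE// (restr m1) (restr m2).
  pose k := NngNum (ltW M0).
  rewrite (_ : M%:E = (k%:num)%:E)// -ge0_integral_mscale//; last exact: measurable_funTS.
  apply: ge0_le_measure_integral => // S mS.
  by rewrite /mscale/= /mrestr; apply: m12 => //; exact: measurableI.
have L21 : L2 m1 f by apply: L2P => //; apply: le_lt_trans le (ltry _).
by split=> //; rewrite -lee_fin -sqnormE.
Qed.

(** * Weighted norms as sums of squares, and the error estimate *)

Lemma beurling_absz (sigma : int -> R) k :
  beurling_weight sigma -> sigma (absz k)%:Z = sigma k.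
Proof. by move=> hs; case: k => n //; rewrite NegzE beurling_even. Qed.

Lemma WnormE (sigma : int -> R) f : beurling_weight sigma ->
  Wnorm sigma f = ((\esum_(k in [set: int])
    ((sigma k * normc (fourier f k)) ^+ 2)%:E) `^ 2^-1)%E.
Proof.
move=> hs; rewrite /Wnorm /lnorm; congr (_ `^ _)%E; apply: eq_esum => k _.
have s0 := beurling_gt0 hs k.
rewrite normcM normc_real gtr0_norm// powR_mulrn//.
by rewrite mulr_ge0 ?normc_ge0// ltW.
Qed.

(** Trades the norm for the sum of squares, where low and high frequencies can be added. The sum may
    be infinite, so monotonicity of extended powers is used both ways. *)
Lemma Wnorm_le (sigma : int -> R) f c : beurling_weight sigma -> 0 <= c ->
  (\esum_(k in [set: int]) ((sigma k * normc (fourier f k)) ^+ 2)%:E <= (c ^+ 2)%:E)%E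
  <-> (Wnorm sigma f <= c%:E)%E.
Proof.
move=> hs c0; rewrite WnormE//; set S := (\esum_(_ in _) _)%E.
have S0 : (0 <= S)%E by apply: esum_ge0 => k _; rewrite lee_fin sqr_ge0.
have cE : (c%:E = (c ^+ 2)%:E `^ 2^-1)%E.
  by rewrite poweR_EFin powR12_sqrt ?sqr_ge0// sqrtr_sqr ger0_norm.
split=> h.
  rewrite cE; apply: gt0_ler_poweR => //; rewrite in_itv/= leey andbT//.
  by rewrite lee_fin sqr_ge0.
have SE : (S = (S `^ 2^-1) `^ 2)%E by rewrite -poweRrM mulVf ?poweRe1// pnatr_eq0.
rewrite SE -[c ^+ 2](@powR_mulrn _ c 2)// -poweR_EFin.
by apply: gt0_ler_poweR => //; rewrite in_itv/= leey andbT// poweR_ge0.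
Qed.

Lemma le_esumZl (I : choiceType) (D : set I) (a : I -> R) (c : R) : 0 <= c ->
  (forall i, 0 <= a i) ->
  (\esum_(i in D) (c * a i)%:E <= c%:E * \esum_(i in D) (a i)%:E)%E.
Proof.
move=> c0 a0; apply: ge_ereal_sup => _ [X [finX XD] <-].
rewrite fsbig_finite//=; under eq_bigr do rewrite EFinM.
rewrite -ge0_sume_distrr => [|i _]; last by rewrite lee_fin.
rewrite -fsbig_finite//= lee_wpmul2l ?lee_fin//.
by apply: esum_ge; exists X.
Qed.

(* The frequencies of f - p below K are controlled in L^2 alone, because tau is
   at most tau K there while sigma is at least sigma K beyond. *)
Lemma Wnorm_error (sigma tau : int -> R) K f r (B : R) :
  beurling_weight sigma -> beurling_weight tau ->
  (forall a b : nat, (a <= b)%N -> tau b%:Z / sigma b%:Z <= tau a%:Z / sigma a%:Z) ->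
  L2 leb f -> (Wnorm sigma f <= 1)%E -> 0 <= B ->
  (forall k, k \notin freq_seq K -> fourier r k = fourier f k) ->
  2 * pi * \sum_(k <- freq_seq K) normc (fourier r k) ^+ 2 <=
    B * sqnorm leb (fun x => f x - truncation K f x) ->
  (Wnorm tau r <= (Num.sqrt (1 + B) * (tau K%:Z / sigma K%:Z))%:E)%E.
Proof.
move=> hs ht hdecr f2 fW B0 rf rB.
have s0 := beurling_gt0 hs; have t0 := beurling_gt0 ht.
set a := tau K%:Z / sigma K%:Z.
have a0 : 0 < a by rewrite divr_gt0.
have pi0 := pi_gt0 R.
have {fW} fS : (\esum_(k in [set: int]) ((sigma k * normc (fourier f k)) ^+ 2)%:E <= 1)%E.
  by have /(Wnorm_le f hs ler01) := fW; rewrite expr1n.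
have big k : k \notin freq_seq K -> (K <= absz k)%N by rewrite mem_freq_seq; lia.
have small k : k \in freq_seq K -> (absz k <= K)%N by rewrite mem_freq_seq; lia.
apply/(Wnorm_le r ht); first by rewrite mulr_ge0 ?sqrtr_ge0// ltW.
rewrite exprMn sqr_sqrtr ?addr_ge0// mulrDl mul1r addrC EFinD.
rewrite (esumID (freqs K)); last by move=> k _; rewrite lee_fin sqr_ge0.
(* With a = tau(K) / sigma(K), the low frequencies receive the share B a^2 and the high ones a^2. *)
rewrite !setTI; apply: leeD.
  rewrite esum_fset; [|exact: finite_freqs|by move=> k _; rewrite lee_fin sqr_ge0].
  rewrite fsumEFin; last exact: finite_freqs.
  rewrite lee_fin fsum_freqs.
  apply: (@le_trans _ _ (tau K%:Z ^+ 2 *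
      \sum_(k <- freq_seq K) normc (fourier r k) ^+ 2)).
    rewrite mulr_sumr big_seq [leRHS]big_seq; apply: ler_sum => k kK.
    rewrite exprMn ler_wpM2r ?sqr_ge0// ler_sqr ?nnegrE ?(ltW (t0 _))//.
    rewrite -(beurling_absz k ht); exact: (beurling_nondecreasing ht (small _ kK)).
  (* Parseval for f - D_K f: its coefficients vanish below K, and from K on sigma is at least
     sigma(K), so the weighted norm of f controls them. *)
  have Qf : sqnorm leb (fun x => f x - truncation K f x) <= 2 * pi * (sigma K%:Z ^- 2).
    have t2 := L2_truncation K f (@lebesgue_circle_fin R).
    rewrite -lee_fin; apply: le_trans (parseval_le (L2B f2 t2)) _.
    rewrite [leRHS]EFinM lee_wpmul2l ?lee_fin ?mulr_ge0 ?(ltW pi0)//.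
    apply: (@le_trans _ _ (\esum_(k in [set: int])
      (sigma K%:Z ^- 2 * (sigma k * normc (fourier f k)) ^+ 2)%:E)%E).
      apply: le_esum => k _; rewrite lee_fin fourierB// fourier_truncation.
      have sK : 0 < sigma K%:Z ^- 2 by rewrite invr_gt0 exprn_gt0.
      case: ifPn => kK.
        by rewrite subrr normc0 expr0n mulr_ge0 ?sqr_ge0// ltW.
      rewrite subr0 exprMn mulrA ler_peMl ?sqr_ge0// mulrC ler_pdivlMr ?exprn_gt0// mul1r.
      rewrite ler_sqr ?nnegrE ?(ltW (s0 _))// -(beurling_absz k hs).
      exact: (beurling_nondecreasing hs (big _ kK)).
    apply: le_trans (le_esumZl _ _ _) _.
    - by rewrite invr_ge0 sqr_ge0.
    - by move=> k; rewrite sqr_ge0.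
    - by rewrite -[leRHS]mule1 lee_wpmul2l// lee_fin invr_ge0 sqr_ge0.
  have S : \sum_(k <- freq_seq K) normc (fourier r k) ^+ 2 <= B * sigma K%:Z ^- 2.
    have p2 : 0 < 2 * pi :> R by rewrite mulr_gt0.
    rewrite -(ler_pM2l p2); apply: le_trans rB _.
    by rewrite mulrCA; exact: ler_wpM2l.
  apply: le_trans (ler_wpM2l (sqr_ge0 _) S) _.
  by rewrite /a expr_div_n mulrCA.
(* At the remaining frequencies |k| >= K, so the decrease of tau / sigma gives tau(k) <= a
   sigma(k). *)
apply: (@le_trans _ _ (\esum_(k in ~` freqs K)
    (a ^+ 2 * (sigma k * normc (fourier f k)) ^+ 2)%:E)%E).
  apply: le_esum => k kK; have {}kK : k \notin freq_seq K.
    by rewrite mem_freq_seq; apply/negP.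
  have n0 := normc_ge0 (fourier f k).
  have ? : 0 <= tau k * normc (fourier f k) by rewrite mulr_ge0// ltW.
  have ? : 0 <= a * (sigma k * normc (fourier f k)).
    by rewrite mulr_ge0 ?(ltW a0)// mulr_ge0// ltW.
  rewrite lee_fin rf// -exprMn ler_sqr ?nnegrE//.
  rewrite mulrA ler_wpM2r ?normc_ge0// -ler_pdivrMr//.
  rewrite -(beurling_absz k hs) -(beurling_absz k ht); apply: hdecr; exact: big.
apply: le_trans (le_esumZl _ _ _) _.
- exact: sqr_ge0.
- by move=> k; rewrite sqr_ge0.
rewrite -[leRHS]mule1 lee_wpmul2l ?lee_fin ?sqr_ge0//; apply: le_trans fS.
rewrite [leRHS](esumID (freqs K)); last by move=> k _; rewrite lee_fin sqr_ge0.
by rewrite !setTI leeDr// esum_ge0// => k _; rewrite lee_fin sqr_ge0.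
Qed.

(** * Operator norms of the projection errors *)

Lemma fourier_residual K f p k : L2 leb f -> trigpoly K p -> k \notin freq_seq K ->
  fourier (fun x => f x - p x) k = fourier f k.
Proof.
move=> f2 /trigpolyP[c ->] kK; have c2 := L2_trig_sum (freq_seq K) c (@lebesgue_circle_fin R).
by rewrite fourierB// fourier_trig_sum ?freq_seq_uniq// (negbTE kK) subr0.
Qed.

(** The case B = 0 of [Wnorm_error]: the coefficients of f - D_K f below K vanish. *)
Lemma opnorm_truncation_le (sigma tau : int -> R) K :
  beurling_weight sigma -> beurling_weight tau ->
  (forall a b : nat, (a <= b)%N -> tau b%:Z / sigma b%:Z <= tau a%:Z / sigma a%:Z) ->
  (opnorm sigma tau (idB (@truncation R K)) <= (tau K%:Z / sigma K%:Z)%:E)%E.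
Proof.
move=> hs ht hdecr; apply: ge_ereal_sup => _ [f [[[_ mf foo] _] fW] <-].
have f2 : L2 leb f by exact: L2P.
have := @Wnorm_error sigma tau K f (idB (@truncation R K) f) 0 hs ht hdecr f2 fW (lexx 0).
rewrite addr0 sqrtr1 mul1r; apply.
  by move=> k kK; apply: fourier_residual kK => //; exact: trigpoly_truncation.
rewrite mul0r big_seq big1 ?mulr0// => k kK.
rewrite fourierB//; last by apply: L2_truncation; exact: lebesgue_circle_fin.
by rewrite fourier_truncation kK subrr normc0 expr0n.
Qed.

Lemma on_circle_expi (n : nat) : on_circle (@expi R n%:Z).
Proof.
rewrite /on_circle; elim: n => [|n IH] x; first by rewrite !expi0.
rewrite -addn1 PoszD !expiD IH; congr (_ * _).
by rewrite /expi !mul1r mulr_natl cosD2pi sinD2pi.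
Qed.

(** The extremal function is e^{iKx} / sigma(K). Its W^sigma norm is 1, and D_K annihilates it
    because K is the first frequency beyond the truncation. *)
Lemma opnorm_truncation_ge (sigma tau : int -> R) K :
  beurling_weight sigma -> beurling_weight tau ->
  ((tau K%:Z / sigma K%:Z)%:E <= opnorm sigma tau (idB (@truncation R K)))%E.
Proof.
move=> hs ht; have s0 := beurling_gt0 hs; have t0 := beurling_gt0 ht.
have loo := @lebesgue_circle_fin R.
pose f x : R[i] := (sigma K%:Z)^-1%:C * expi K%:Z x.
have f2 : L2 leb f by apply: L2Z; exact: L2_expi.
have Ff k : fourier f k = (sigma K%:Z)^-1%:C * (k == K%:Z)%:R.
  by rewrite fourierZ ?fourier_expi 1?eq_sym//; exact: L2_expi.
(* Used for [sigma] with [f] itself and for [tau] with its truncation error, which has the same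
   coefficients. *)
have W1 (rho : int -> R) g : beurling_weight rho ->
    (forall k, fourier g k = fourier f k) -> Wnorm rho g = (rho K%:Z / sigma K%:Z)%:E.
  move=> hr gf; have r0 := beurling_gt0 hr.
  have rs : 0 < rho K%:Z / sigma K%:Z by rewrite divr_gt0.
  rewrite WnormE//.
  rewrite (_ : (\esum_(_ in _) _)%E = ((rho K%:Z / sigma K%:Z) ^+ 2)%:E).
    by rewrite poweR_EFin powR12_sqrt ?sqr_ge0// sqrtr_sqr gtr0_norm.
  rewrite -[RHS](@esum_set1 _ _ K%:Z (fun=> ((rho K%:Z / sigma K%:Z) ^+ 2)%:E)).
    rewrite [RHS]esum_mkcond; apply: eq_esum => k _; rewrite gf Ff.
    have [->|kK] := eqVneq k K%:Z.
      by rewrite mem_set// mulr1 normc_real gtr0_norm ?invr_gt0.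
    rewrite memNset; last exact/eqP.
    by rewrite mulr0 normc0 mulr0 expr0n.
  by rewrite lee_fin sqr_ge0.
apply: ereal_sup_ubound; exists f.
  split; last by rewrite (W1 sigma)// divff ?lexx// gt_eqF.
  split; last by rewrite (W1 sigma)// ltry.
  split; last by rewrite sqnormE// ltry.
    by move=> x; rewrite /f on_circle_expi.
  by case: f2.
apply: W1 => // k; rewrite fourierB//; last exact: L2_truncation.
rewrite fourier_truncation; case: ifPn; last by rewrite subr0.
rewrite mem_freq_seq Ff => kK; rewrite (_ : (k == _) = false) ?mulr0 ?subr0//.
by apply/negbTE; apply: contraTneq kK => ->; lia.
Qed.

(** Integrate h <= M and 1 <= M h over S. The two inequalities allow passing between the two L^2
    norms in either direction. *)
Lemma density_le_lebesgue m (h : R -> R) (M : R) : measurable_fun [set: R] h ->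
  has_density m h -> 0 < M -> (forall x, M^-1 <= h x <= M) ->
  forall S, measurable S -> S `<=` circle R ->
    (m S <= M%:E * leb S)%E /\ (leb S <= M%:E * m S)%E.
Proof.
move=> mh hm M0 hM S mS SD.
have h0 x : 0 <= h x by case/andP: (hM x) => + _; apply: le_trans; rewrite invr_ge0 ltW.
have mhS : measurable_fun S (fun x => (h x)%:E).
  by apply/measurable_EFinP; exact: measurable_funTS.
rewrite hm//; split.
  rewrite -(@integral_cst _ _ R leb S mS M%:E); apply: ge0_le_integral => //.
  - by move=> x _; rewrite lee_fin.
  - by move=> x _; rewrite /= lee_fin; case/andP: (hM x).
rewrite -ge0_integralZl//; last 2 first.
- by move=> x _; rewrite lee_fin.
- by rewrite lee_fin ltW.
rewrite -[leLHS]mul1e -(@integral_cst _ _ R leb S mS 1%:E); apply: ge0_le_integral => //.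
- by apply: emeasurable_funM => //; exact: measurable_cst.
- move=> x _; rewrite /= lee_fin -ler_pdivrMl// mulr1.
  by case/andP: (hM x).
Qed.

Lemma opnorm_orthproj_le (sigma tau : int -> R) m (h : R -> R) (M : R) K :
  beurling_weight sigma -> beurling_weight tau ->
  (forall a b : nat, (a <= b)%N -> tau b%:Z / sigma b%:Z <= tau a%:Z / sigma a%:Z) ->
  measurable_fun [set: R] h -> has_density m h -> 0 < M ->
  (forall x, M^-1 <= h x <= M) ->
  (opnorm sigma tau (idB (orthproj m K)) <=
    (Num.sqrt (1 + M ^+ 2) * (tau K%:Z / sigma K%:Z))%:E)%E.
Proof.
move=> hs ht hdecr mh hm M0 hM; have cmp := density_le_lebesgue mh hm M0 hM.
have loo := @lebesgue_circle_fin R.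
have moo : (m (circle R) < +oo)%E.
  have [le _] := cmp _ (@measurable_circle R) (@subset_refl _ _).
  by apply: le_lt_trans le _; rewrite lebesgue_circle -EFinM ltry.
apply: ge_ereal_sup => _ [f [[[_ mf foo] _] fW] <-].
have f2 : L2 leb f by exact: L2P.
have m1 g : L2 leb g -> L2 m g /\ sqnorm m g <= M * sqnorm leb g.
  by move=> g2; apply: sqnorm_le_measure => // S mS SD; case: (cmp S mS SD).
have m2 g : L2 m g -> L2 leb g /\ sqnorm leb g <= M * sqnorm m g.
  by move=> g2; apply: sqnorm_le_measure => // S mS SD; case: (cmp S mS SD).
have [fm _] := m1 f f2; have op := orthprojP K moo fm; have pK := op.1.
have p2 : L2 leb (orthproj m K f) by case/trigpolyP: pK => c ->; exact: L2_trig_sum.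
have t2 := L2_truncation K f loo.
apply: (Wnorm_error hs ht hdecr f2 fW (sqr_ge0 M)).
  by move=> k; exact: fourier_residual.
have r2 : L2 leb (fun x => f x - orthproj m K f x) by exact: L2B.
have q2 : L2 leb (fun x => f x - truncation K f x) by exact: L2B.
(* Bessel bounds the low coefficients of the residual by its whole L^2 norm. *)
apply: (@le_trans _ _ (sqnorm leb (fun x => f x - orthproj m K f x))).
  by rewrite [leRHS](bessel K r2) lerDr sqnorm_ge0.
(* Best approximation holds in L^2(mu), so the measure is changed before and after it. Each change
   costs a factor M in the squared norm, which gives B = M^2. *)
apply: le_trans (m2 _ (m1 _ r2).1).2 _; rewrite expr2 -mulrA ler_wpM2l ?(ltW M0)//.
apply: le_trans (m1 _ q2).2.
exact: best_approximation moo fm op (trigpoly_truncation K f).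
Qed.

End projection_error.

(** * Combination of the operator norm bounds, with constant sqrt(1 + M^2) *)

Theorem theorem1p1 (R : realType) :
  exists C : R -> R -> R -> R,
    (forall q q' A A' M M' : R, 1 <= q -> 0 <= A -> 0 < M ->
       q <= q' -> A <= A' -> M <= M' -> C q A M <= C q' A' M') /\
    forall (sigma tau : int -> R)
      (hsigma : beurling_weight sigma) (htau : beurling_weight tau)
      (hdecr : forall m n : nat, (m <= n)%N ->
         tau n%:Z / sigma n%:Z <= tau m%:Z / sigma m%:Z)
      (mu : {measure set (measurableTypeR R) -> \bar R}) (h : R -> R) (q A M : R)
      (hper : on_circle h) (hmeas : measurable_fun [set: R] h)
      (hmu : has_density mu h)
      (hM : 0 < M) (hbd : forall x, M^-1 <= h x <= M)
      (hq : 1 <= q)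
      (hA : (lnorm q (fun k => ((sigma k)%:C *
               fourier_deriv (fun x => (ln (h x))%:C) k)%R) <= A%:E)%E)
      (K : nat) (hK : (1 <= K)%N),
      (opnorm sigma tau (idB (orthproj mu K))
         <= (C q A M)%:E * opnorm sigma tau (idB (@truncation R K)))%E /\
      opnorm sigma tau (idB (@truncation R K))
        = (tau K%:Z / sigma K%:Z)%:E.
Proof.
exists (fun _ _ M => Num.sqrt (1 + M ^+ 2)); split.
  move=> q q' A A' M M' _ _ M0 _ _ MM'.
  by rewrite ler_wsqrtr// lerD2l ler_sqr ?nnegrE// ltW// (lt_le_trans M0).
move=> sigma tau hs ht hdecr mu h q A M _ hmeas hmu hM hbd _ _ K _.
have trE : opnorm sigma tau (idB (@truncation R K)) = (tau K%:Z / sigma K%:Z)%:E.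
  by apply/eqP; rewrite eq_le opnorm_truncation_le// opnorm_truncation_ge.
by split=> //; rewrite trE -EFinM; exact: (opnorm_orthproj_le K hs ht hdecr hmeas hmu hM hbd).
Qed.
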